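(* Let $(z_n)$ and $(y_n)$ be the sequences in the Hilbert space $H$ described in the context (in particular $y_0=z_0$). Assume there exist $c\in\mathbb{N}\setminus\{0\}$ and monotone functions $h:\mathbb{N}\to\mathbb{N}\setminus\{0\}$ and $\ell,L,E:\mathbb{N}\to\mathbb{N}$ such that (1) $\lambda_n\ge \frac{1}{h(n)}$ for all $n\in\mathbb{N}$; (2) $\lambda_n\le\frac1{k+1}$ for all $k\in\mathbb{N}$ and $n\ge \ell(k)$; (3) $\sum_{i=1}^{L(k)}\lambda_i\ge k$ for all $k\in\mathbb{N}$; (4) $\min\{c_n,\delta_n^2\}\ge\frac1c$ for all $n\in\mathbb{N}$; (5) either $\sum_{i=E(k)+1}^{E(k)+n}\|e_i\|\le\frac{1}{k+1}$ for all $k,n\in\mathbb{N}$, or $\frac{\|e_n\|}{\lambda_n}\le\frac1{k+1}$ for all $k\in\mathbb{N}$ and $n\ge E(k)$. Let $D\in\mathbb{N}\setminus\{0\}$ be such that $D\ge\max\{2\|u-p\|,\|z_0-p\|\}$ for some $p\in S$, and let $\mathsf{C}:\mathbb{N}\to\mathbb{N}$ be a monotone function with $c_n\le \mathsf{C}(n)$ for all $n\in\mathbb{N}$. Let $B_D=\{z\in H:\|z-p\|\le D\}$ and $s_i^z=\|y_i-z\|^2$. Then for all $k\in\mathbb{N}$ and every monotone function $f:\mathbb{N}\to\mathbb{N}$, $$\exists n\le\mu(k,f)\ \exists z\in B_D\ \forall i\in[n,f(n)]\ \left(s_i^z\le\frac1{k+1}\right),$$ where $\mu(k,f)$ is the explicit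 number defined in the context from $c,D,\mathsf{C},h,\ell,L,k,f$.
   Context: Conventions: $\mathbb{N}=\{0,1,2,\dots\}$; $[a,b]$ with $a,b\in\mathbb{N}$ is the set of integers $i$ with $a\le i\le b$ (empty if $b<a$); $g^{(j)}$ is the $j$-fold iterate of $g$ ($g^{(0)}=\mathrm{id}$); $g+2$ is the function $n\mapsto g(n)+2$. A function $f:\mathbb{N}\to\mathbb{N}$ is monotone if $f(n)\le f(n+1)$ for all $n$. Setting: $H$ is a real Hilbert space, $\mathsf{A}:H\to2^H$ is a maximal monotone operator with $S:=\mathsf{A}^{-1}(0)\ne\emptyset$, and for $\sigma>0$, $J_\sigma=(I+\sigma\mathsf{A})^{-1}$ is its (single-valued, everywhere defined) resolvent. Given are $u,z_0\in H$, $(e_n)\subset H$, $(c_n)\subset(0,+\infty)$, $(\lambda_n),(\delta_n)\subset(0,1)$, $(\gamma_n)\subset[0,1)$ with $\lambda_n+\gamma_n+\delta_n=1$ for all $n\in\mathbb{N}$. The sequences $(z_n),(y_n)$ are defined by $z_{n+1}=\lambda_nu+\gamma_nz_n+\delta_nJ_{c_n}(z_n)+e_n$ and $y_0=z_0$, $y_{n+1}=\lambda_nu+\gamma_ny_n+\delta_nJ_{c_n}(y_n)$. Auxiliary functions (for the given $c,D,\mathsf{C},h,\ell,L$ and given $k\in\mathbb{N}$, monotone $f$), for $j,n\in\mathbb{N}$ and $g:\mathbb{N}\to\mathbb{N}$: - $\zeta(j,n)=c(j+1)\mathsf{C}(n)-1$; - $\overline{\sigma}(j,n)=L\left(n+\lceil\ln(12D^2(j+1))\rceil\right)+1$;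 - $\phi_2(j,n,g)=\max\{n,g^{(4D^2(j+1))}(n)\}$ and $\phi_1(j,n,g)=g(\phi_2(j,n,g))$; - $\widetilde f(n)=f(\overline{\sigma}(k,n))$; - $r_1(n)=12c(n+1)^2-1$; - $r_2(n)=\max\{2(n+1),128D(k+1)^2\}$; - $r_3(n)=\ell\left(\max\{96cD^2(n+1)^2-1,\ 256D^2(k+1)^2-1,\ 16c(r_2(n))^2D^2\}\right)$; - $r_4(n)=3(k+1)\left(\widetilde f(\phi_2(r_1(n),r_3(n),\widetilde f+2))+1\right)$; - $\Phi(n)=\phi_1(r_1(n),r_3(n),\widetilde f+2)$; - $\Xi_1(n)=\zeta\left(2(6D+1)\max\{r_1(n),r_4(n)\}-1,\ \phi_1(r_1(n),r_3(n),\widetilde f+2)\right)$; - $\xi(n)=\zeta\left(\max\{16h(f(n))(k+1)^2(6D+1),\ 4c(r_2(n))^2(6D+1)\},\ f(n)\right)$; - $\Xi_2(n)=\xi(\Phi(n))$ and $\Xi(n)=\max\{\Xi_1(n),\Xi_2(n)\}$. For $j\in\mathbb{N}$ and monotone $g:\mathbb{N}\to\mathbb{N}$: $\beta(j,g)=24D\left(w_g^{(R)}(0)+1\right)^2$ with $R=4D^4(j+1)^2$ and $w_g(m)=\max\{g(24D(m+1)^2),24D(m+1)^2\}$. Finally, with $\overline{k}=32(k+1)^2-1$, $\bar r=r_1(\beta(\overline{k},\Xi))$, $\bar n=r_3(\beta(\overline{k},\Xi))$, $$\mu(k,f)=\max\left\{\overline{\sigma}(k,\phi_2(\bar r,\bar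 n,\widetilde f+2)),\ \Phi(\beta(\overline{k},\Xi))\right\}.$$ *)

(* Defs.v *)
From HB Require Import structures.
From mathcomp Require Import all_boot all_order all_algebra sesquilinear.
From mathcomp Require Import all_classical all_reals all_analysis.

Set Implicit Arguments.
Unset Strict Implicit.
Unset Printing Implicit Defensive.

Import Order.TTheory GRing.Theory Num.Theory.
Import numFieldNormedType.Exports.

Local Open Scope classical_set_scope.

Definition monotone_fun (f : nat -> nat) : Prop := forall n, f n <= f n.+1.

Section operators.
Local Open Scope ring_scope.
Context (R : realType) (H : completeNormedModType R).
Implicit Types (A : H -> set H) (dot : {dot H for (idfun : R -> R)}).

(** A real Hilbert space is a complete normed module [H] over [R] together with
    a positive definite symmetric bilinear form inducing its norm. *)
Definition inner_product dot : Prop := forall x : H, dot x x = `|x| ^+ 2.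

Definition monotone_op dot A : Prop :=
  forall x y u v : H, A x u -> A y v -> 0 <= dot (x - y) (u - v).

Definition maximal_monotone dot A : Prop :=
  monotone_op dot A /\
  forall B : H -> set H, monotone_op dot B ->
    (forall x, A x `<=` B x) -> forall x, B x `<=` A x.

Definition inverse_op A : H -> set H := fun y => [set x | A x y].

Definition zeros A : set H := inverse_op A 0.

(** [(I + s A)^-1], as a set-valued operator. *)
Definition resolvent_op A (s : R) : H -> set H :=
  inverse_op (fun x => [set x + s *: v | v in A x]).

(** [J_s x] is the element of [(I + s A)^-1 x].  When [A] is maximal monotone
    and [0 < s], this set is a singleton by Minty's theorem, so that the
    default value of [get] is irrelevant. *)
Definition resolvent A (s : R) (x : H) : H := get (resolvent_op A s x).

End operators.

(** In all the formulas below, truncated subtractions are only applied to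
    positive numbers as soon as [c], [D] and the values of [Cb] are positive. *)
Section bounds.
Local Open Scope nat_scope.
Context (R : realType) (c D : nat) (Cb h ell L : nat -> nat).
Implicit Types (f g : nat -> nat) (j k n m : nat).

Definition zeta j n : nat := c * (j + 1) * Cb n - 1.

(** The ceiling is nonnegative when [0 < D], hence equal to its absolute
    value. *)
Definition sigma_bar j n : nat :=
  L (n + `|Num.ceil (ln ((12 * D ^ 2 * (j + 1))%:R : R))|) + 1.

Definition phi2 j n g : nat := maxn n (iter (4 * D ^ 2 * (j + 1)) g n).
Definition phi1 j n g : nat := g (phi2 j n g).

Definition w g m : nat :=
  maxn (g (24 * D * (m + 1) ^ 2)) (24 * D * (m + 1) ^ 2).

Definition beta j g : nat :=
  24 * D * (iter (4 * D ^ 4 * (j + 1) ^ 2) (w g) 0 + 1) ^ 2.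

Definition r1 n : nat := 12 * c * (n + 1) ^ 2 - 1.

Definition r2 k n : nat := maxn (2 * (n + 1)) (128 * D * (k + 1) ^ 2).

Definition r3 k n : nat :=
  ell (maxn (96 * c * D ^ 2 * (n + 1) ^ 2 - 1)
      (maxn (256 * D ^ 2 * (k + 1) ^ 2 - 1)
            (16 * c * r2 k n ^ 2 * D ^ 2))).

Definition f_tilde k f n : nat := f (sigma_bar k n).

Definition f_tilde2 k f n : nat := f_tilde k f n + 2.

Definition r4 k f n : nat :=
  3 * (k + 1) * (f_tilde k f (phi2 (r1 n) (r3 k n) (f_tilde2 k f)) + 1).

Definition Phi k f n : nat := phi1 (r1 n) (r3 k n) (f_tilde2 k f).

Definition Xi1 k f n : nat :=
  zeta (2 * (6 * D + 1) * maxn (r1 n) (r4 k f n) - 1)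
       (phi1 (r1 n) (r3 k n) (f_tilde2 k f)).

Definition xi k f n : nat :=
  zeta (maxn (16 * h (f n) * (k + 1) ^ 2 * (6 * D + 1))
             (4 * c * r2 k n ^ 2 * (6 * D + 1)))
       (f n).

Definition Xi2 k f n : nat := xi k f (Phi k f n).

Definition Xi k f n : nat := maxn (Xi1 k f n) (Xi2 k f n).

Definition mu k f : nat :=
  let b := beta (32 * (k + 1) ^ 2 - 1) (Xi k f) in
  maxn (sigma_bar k (phi2 (r1 b) (r3 k b) (f_tilde2 k f))) (Phi k f b).

End bounds.

(* Main.v *)
Require Import Defs.
From HB Require Import structures.
From mathcomp Require Import all_boot all_order all_algebra sesquilinear.
From mathcomp Require Import all_classical all_reals all_analysis.
From mathcomp Require Import ring lra zify.
Import Order.TTheory GRing.Theory Num.Theory.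
Import numFieldNormedType.Exports.
Local Open Scope classical_set_scope.
Local Open Scope ring_scope.

(** The quantity [s_i = |y_i - q|^2] satisfies, for every [q] in the ball of
    radius [D] around the zero [p] that [J_{c_i}] moves by at most [eps],

      [s_{i+1} + delta_i^2 |y_i - J_{c_i} y_i|^2
         <= (1 - lambda_i) s_i + 2 lambda_i <u - q, y_{i+1} - q> + 12 D eps]

    (lemma [key_recurrence], a consequence of firm nonexpansiveness).  Were [q]
    the projection of [u] onto the zeros of [A], the inner product would be
    asymptotically nonpositive, and [s_i] would tend to [0], but without an
    explicit rate.  Therefore [q] is a point that is good enough for finitely
    many indices only: [approx_projection] gives [N <= beta] and a [q] that
    is fixed by [J_{1/c}] up to [1/(Xi N + 1)], and such that
    [<u - q, q' - q>] is at most [1/(32(k+1)^2)] for all [q'] of the ball that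
    are fixed up to [1/(N + 1)].  It is found by descent: each failure lowers
    [|u - q|^2] by a fixed amount, which can happen only boundedly often;
    convex combinations of approximate fixed points being approximate fixed
    points, near-minimality then yields the variational inequality.

    With this [q], there are two possibilities for [s] on the window
    [r3 N, Phi N], unless [f~ (r3 N) + 2 < r3 N], when the interval to be
    controlled is empty for [n = sigma_bar k (r3 N)].

    If [s] does not increase there, it is a bounded monotone sequence, so it
    varies by at most [1/(r1 N + 1)] on some subwindow [m, f~ m + 2]
    (lemma [phi2_metastable]).  The recurrence makes the residuals, hence the
    inner products, small on that subwindow, and the divergence of the sum of
    the [lambda_i] turns the recurrence into [s_i <= 1/(k+1)] from
    [sigma_bar k m] on (lemma [decrease_bound]).

    If [s_t < s_{t+1}] for some [t] of the window, then every later [s_i] is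
    bounded by [s_{tau+1}], where [tau] is the last index up to [i] at which
    [s] increases (lemma [last_increase]).  At such an increase the recurrence
    gives at once that the residual is small, that [<u - q, y_{tau+1} - q>] is
    small, and after division by [lambda_tau] that [s_{tau+1}] is small
    (lemma [increase_bound]).

    All this speaks about the values of the resolvents, which are chosen by
    [get]; they are meaningful because of Minty's theorem.  It is obtained from
    [minty_point], which finds a point monotonically related to a given
    monotone graph as the limit of a minimising sequence of a strongly convex
    function on the convex hull of that graph. *)

Set Implicit Arguments.
Unset Strict Implicit.
Unset Printing Implicit Defensive.

(** * Real Hilbert spaces and Minty's theorem *)

Section HilbertSpace.
Context (R : realType) (H : completeNormedModType R).
Context (dot : {dot H for (idfun : R -> R)}).
Hypothesis hdot : inner_product dot.
Implicit Types x y z u v w : H.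

Lemma dotC x y : dot x y = dot y x.
Proof. by rewrite hermC /= expr0 mul1r. Qed.

Lemma dotDl x y z : dot (x + y) z = dot x z + dot y z.
Proof. exact: linearDl. Qed.

Lemma dotNl x z : dot (- x) z = - dot x z.
Proof. exact: linearNl. Qed.

Lemma dotZl a x z : dot (a *: x) z = a * dot x z.
Proof. exact: linearZl_LR. Qed.

Lemma dot0l z : dot 0 z = 0.
Proof. exact: linear0l. Qed.

Lemma dot0r z : dot z 0 = 0.
Proof. exact: linear0r. Qed.

Lemma dotDr x y z : dot z (x + y) = dot z x + dot z y.
Proof. by rewrite !(dotC z) dotDl. Qed.

Lemma dotNr x z : dot z (- x) = - dot z x.
Proof. by rewrite !(dotC z) dotNl. Qed.

Lemma dotZr a x z : dot z (a *: x) = a * dot z x.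
Proof. by rewrite !(dotC z) dotZl. Qed.

Definition dotE := (dotDl, dotDr, dotNl, dotNr, dotZl, dotZr).

Lemma dot_ge0 x : 0 <= dot x x.
Proof. by rewrite hdot sqr_ge0. Qed.

Lemma dot_le_norm x y : dot x y <= `|x| * `|y|.
Proof.
have [->|y0] := eqVneq y 0.
  by rewrite normr0 mulr0 dot0r.
have ny : 0 < `|y| by rewrite normr_gt0.
have := dot_ge0 (`|y| *: x - `|x| *: y).
rewrite !dotE !hdot (dotC y x).
have [->|x0] := eqVneq x 0.
  by rewrite normr0 mul0r dot0l.
have nx : 0 < `|x| by rewrite normr_gt0.
have nxy : 0 < `|x| * `|y| by apply: mulr_gt0.
nra.
Qed.

(** The convex hull of the points [(y, v, <y, v>)], for [(y, v)] in the graph.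
    Keeping the value of the inner product as a third coordinate turns
    monotonicity into a property that is affine in each point separately. *)
Inductive graph_hull (P : H -> H -> Prop) : H -> H -> R -> Prop :=
| graph_hull_point y v : P y v -> graph_hull P y v (dot y v)
| graph_hull_mix t y v r y' v' r' : 0 <= t <= 1 ->
    graph_hull P y v r -> graph_hull P y' v' r' ->
    graph_hull P (t *: y + (1 - t) *: y') (t *: v + (1 - t) *: v')
                 (t * r + (1 - t) * r').

Definition monotone_graph (P : H -> H -> Prop) :=
  forall y v y' v', P y v -> P y' v' -> 0 <= dot (y - y') (v - v').

(** Monotonicity of two points of the graph reads
    [<y1, v2> + <y2, v1> <= r1 + r2], which is affine in either point, hence
    passes to the hull in one point and then in the other; the claim is the
    case of two equal points. *)
Lemma graph_hull_ge (P : H -> H -> Prop) y v r : monotone_graph P ->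
  graph_hull P y v r -> dot y v <= r.
Proof.
move=> mP.
suff pol y1 v1 r1 y2 v2 r2 : graph_hull P y1 v1 r1 -> graph_hull P y2 v2 r2 ->
    dot y1 v2 + dot y2 v1 <= r1 + r2.
  by move=> h; have := pol _ _ _ _ _ _ h h; lra.
move=> h1 h2; elim: h1 => {y1 v1 r1} [y1 v1 P1|t a b s a' b' s' t01 _ IH _ IH'].
  elim: h2 => {y2 v2 r2} [y2 v2 P2|t a b s a' b' s' t01 _ IH _ IH'].
    have := mP _ _ _ _ P1 P2; rewrite !dotE; lra.
  rewrite !dotE; nra.
rewrite !dotE; nra.
Qed.

(** For a point of the graph this is [|y + v|^2 / 4]. *)
Definition excess y v r : R := r + dot (y - v) (y - v) / 4.

Lemma excess_mix t y v r y' v' r' :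
  excess (t *: y + (1 - t) *: y') (t *: v + (1 - t) *: v')
         (t * r + (1 - t) * r') =
  t * excess y v r + (1 - t) * excess y' v' r'
  - t * (1 - t) * (dot (y - v - (y' - v')) (y - v - (y' - v')) / 4).
Proof.
rewrite /excess !dotE (dotC v y) (dotC v' y') (dotC y' y) (dotC v' v).
by rewrite (dotC v' y) (dotC v y'); field.
Qed.

Lemma graph_hull_excess_ge0 (P : H -> H -> Prop) y v r : monotone_graph P ->
  graph_hull P y v r -> 0 <= excess y v r.
Proof.
move=> mP h; have := graph_hull_ge mP h; have := dot_ge0 (y + v).
by rewrite /excess !dotE (dotC v y); lra.
Qed.

Lemma cauchy_norm_cvg (x : nat -> H) :
  (forall e : R, 0 < e -> exists N, forall n m,
     (N <= n)%N -> (N <= m)%N -> `|x n - x m| < e) -> cvgn x.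
Proof.
move=> hx; apply: cauchy_cvg; apply: cauchy_exP => e e0.
have [N hN] := hx e e0; exists (x N); exists N => // n /= Nn.
by rewrite -ball_normE /=; apply: hN.
Qed.
(** A nonnegative strongly convex function (here the relation [K x a], with
    [a] a value at [x]) has a point that is closer to every [x] than the value
    at [x] tells.  The limit of a minimising sequence has this property: near
    optimal points are close to each other by the midpoint inequality, and
    moving a little from such a point towards [x] cannot gain much. *)
Lemma strongly_convex_center (K : H -> R -> Prop) :
  (exists x a, K x a) -> (forall x a, K x a -> 0 <= a) ->
  (forall t x a x' a', 0 <= t <= 1 -> K x a -> K x' a' ->
     K (t *: x + (1 - t) *: x')
       (t * a + (1 - t) * a' - t * (1 - t) * `|x - x'| ^+ 2)) ->
  exists w, forall x a, K x a -> `|w - x| ^+ 2 <= a.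
Proof.
move=> [x0 [a0 K0]] Kge0 Kmix.
pose E := [set a | exists x, K x a].
have Elb : lbound E 0 by move=> a [x /Kge0].
have Einf : has_inf E by split; [exists a0, x0 | exists 0].
pose M := inf E.
have M0 : 0 <= M by apply: lb_le_inf => //; case: Einf.
have ME x a : K x a -> M <= a by move=> Kxa; apply: ge_inf; [exists 0|exists x].
pose s n : R := n.+1%:R^-1.
have s0 n : 0 < s n by rewrite invr_gt0 ltr0n.
have s1 n : s n <= 1 by rewrite invf_le1 ?ltr0n// ler1n.
have [X hX] : exists X : nat -> H, forall n, exists2 a, K (X n) a & a < M + s n ^+ 2.
  suff /choice[X hX] : forall n, exists x, exists2 a, K x a & a < M + s n ^+ 2.
    by exists X.
  move=> n.
  have [|a [x Kxa] aM] := inf_adherent _ Einf (eps := s n ^+ 2).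
    by rewrite exprn_gt0.
  by exists x, a.
have sle n m : (n <= m)%N -> s m <= s n.
  by move=> nm; rewrite lef_pV2 ?posrE ?ltr0n// ler_nat.
have Xclose N n m : (N <= n)%N -> (N <= m)%N -> `|X n - X m| <= 2 * s N.
  move=> /sle Nn /sle Nm; have [a Ka aM] := hX n; have [b Kb bM] := hX m.
  have h2 : 0 <= (2^-1 : R) <= 1 by lra.
  have := ME _ _ (Kmix _ _ _ _ _ h2 Ka Kb).
  rewrite -[_ <= 2 * s N](@ler_pXn2r _ 2%N) ?nnegrE ?mulr_ge0 ?normr_ge0 ?(ltW (s0 N))//.
  have sq i : s i <= s N -> s i ^+ 2 <= s N ^+ 2.
    by move=> h; rewrite ler_sqr ?nnegrE ?(ltW (s0 _)).
  by have := sq _ Nn; have := sq _ Nm; rewrite exprMn; lra.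
have cvX : cvgn X.
  apply: cauchy_norm_cvg => e e0.
  have [N hN] : exists N, 2 * s N < e.
    exists (Num.truncn (2 / e)); rewrite /s ltr_pdivrMr ?ltr0n//.
    by rewrite mulrC -ltr_pdivrMr// truncnS_gt.
  by exists N => n m Nn Nm; apply: le_lt_trans (Xclose N n m Nn Nm) hN.
exists (limn X) => x a Kxa.
have sl : s @ \oo --> (0 : R) by apply: cvg_harmonic.
have cl : (fun n => (1 - s n) * `|X n - x| ^+ 2) @ \oo -->
    (1 - 0) * `|limn X - x| ^+ 2.
  apply: cvgM; first by apply: cvgB => //; exact: cvg_cst.
  apply: (@cvg_comp _ _ _ (fun n => `|X n - x|) (fun r => r ^+ 2)); last first.
    exact: exprn_continuous.
  by apply: cvg_norm; apply: cvgB => //; exact: cvg_cst.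
have cr : (fun n => a + s n) @ \oo --> a + 0.
  by apply: cvgD => //; exact: cvg_cst.
rewrite subr0 mul1r addr0 in cl cr.
apply: (ler_cvg_to cl cr); apply: nearW => n.
have [b Kb bM] := hX n.
have h2 : 0 <= s n <= 1 by rewrite s1 ltW.
(* The value at [X n] is within [s n ^+ 2] of the infimum, so a step of length
   [s n] towards [x] leaves an error of only [s n] after division by [s n]. *)
have := ME _ _ (Kmix _ _ _ _ _ h2 Kxa Kb).
rewrite distrC; have := s0 n; have := s1 n; set d := `|_| ^+ 2.
move=> n1 n0 h; rewrite -(ler_pM2l n0).
nra.
Qed.

(** The condition on [w] says that [|w - (y - v)/2| <= |y + v|/2] for all
    points of the graph.  The right-hand side squared is the excess of the
    point, and the excess is strongly convex on the hull as a function of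
    [(y - v)/2], so that [strongly_convex_center] applies. *)
Lemma minty_point (P : H -> H -> Prop) : monotone_graph P ->
  exists w, forall y v, P y v -> 0 <= dot (w - y) (- w - v).
Proof.
move=> mP.
have [[y0 [v0 P0]]|noP] := pselect (exists y v, P y v); last first.
  by exists 0 => y v Pyv; case: noP; exists y, v.
pose K x a := exists y v r,
  [/\ graph_hull P y v r, x = 2^-1 *: (y - v) & a = excess y v r].
have [|x a [y [v [r [/(graph_hull_excess_ge0 mP) ? _ ->]]]]||w hw] //
  := @strongly_convex_center K.
- exists (2^-1 *: (y0 - v0)), (excess y0 v0 (dot y0 v0)), y0, v0, (dot y0 v0).
  by split=> //; exact: graph_hull_point.
- move=> t _ _ _ _ t01 [y [v [r [h -> ->]]]] [y' [v' [r' [h' -> ->]]]].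
  exists (t *: y + (1 - t) *: y'), (t *: v + (1 - t) *: v'), (t * r + (1 - t) * r').
  split; first exact: graph_hull_mix.
    rewrite !(scalerBr, scalerDr, scalerA) ![_ * 2^-1]mulrC.
    by rewrite opprD addrACA.
  rewrite excess_mix -hdot -scalerBr dotZl dotZr; by congr (_ - _ * _); field.
exists w => y v Pyv.
have := hw _ _ (ex_intro _ y (ex_intro _ v (ex_intro _ _
  (And3 (graph_hull_point Pyv) erefl erefl)))).
rewrite -hdot /excess !dotE (dotC v y) (dotC v w) (dotC y w); lra.
Qed.

End HilbertSpace.


(** * Resolvents of maximal monotone operators *)

Section Resolvent.
Context (R : realType) (H : completeNormedModType R).
Context (dot : {dot H for (idfun : R -> R)}).
Hypothesis hdot : inner_product dot.
Implicit Types x y z u v w : H.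

Local Notation dotE := (@dotE R H dot).
Local Notation dotC := (@dotC R H dot).

Section MaximalMonotone.
Context (A : H -> set H).
Hypothesis hA : maximal_monotone dot A.
Local Notation J := (resolvent A).

(** Minty's theorem.  Applied to the graph shifted by [x] and scaled by [s],
    [minty_point] gives a point that can be added to the graph of [A] without
    breaking monotonicity; by maximality it is already there. *)
Lemma resolventP s x : 0 < s -> A (J s x) (s^-1 *: (x - J s x)).
Proof.
move=> s0; have [mA maxA] := hA.
have sN0 : s != 0 by rewrite gt_eqF.
have si0 : 0 < s^-1 by rewrite invr_gt0.
have mP : monotone_graph dot (fun y v => A (x + y) (s^-1 *: v)).
  move=> y v y' v' /mA/[apply].
  by rewrite opprD addrACA subrr add0r -scalerBr dotZr pmulr_rge0.
have [w hw] := minty_point hdot mP.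
pose B y : set H := fun v => A y v \/ (y = x + w /\ v = s^-1 *: (- w)).
have wA v y : A y v -> 0 <= dot (y - (x + w)) (v - s^-1 *: (- w)).
  move=> Ayv; have := hw (y - x) (s *: v).
  rewrite subrKC scalerA mulVf// scale1r => /(_ Ayv) h.
  rewrite -(pmulr_rge0 _ s0) -dotZr scalerBr scalerA divff// scale1r.
  suff -> : dot (y - (x + w)) (s *: v - - w) =
            dot (w - (y - x)) (- w - s *: v) by [].
  by rewrite !dotE; ring.
have AB : B (x + w) `<=` A (x + w).
  apply: maxA => [y y' v v' [?|[-> ->]] [?|[-> ->]]|y v Ayv]; last by left.
  - exact: mA.
  - exact: wA.
  - by rewrite -opprB -[_ - v']opprB dotNl dotNr opprK wA.
  - by rewrite !subrr dot0l.
have /getPex [v Jv xE] : exists y, resolvent_op A s x y.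
  exists (x + w), (s^-1 *: (- w)); first by apply: AB; right.
  by rewrite scalerA divff// scale1r addrK.
rewrite -/(resolvent A s x) in Jv xE.
by rewrite -{2}xE addrAC subrr add0r scalerA mulVf// scale1r.
Qed.

Lemma resolvent_firm s x y : 0 < s ->
  dot (J s x - J s y) (J s x - J s y) <= dot (J s x - J s y) (x - y).
Proof.
move=> s0; have := hA.1 _ _ _ _ (resolventP x s0) (resolventP y s0).
rewrite -scalerBr dotZr pmulr_rge0 ?invr_gt0// => h.
by rewrite -subr_ge0; apply: le_trans h _; rewrite !dotE; lra.
Qed.

Lemma resolvent_nonexp s x y : 0 < s -> `|J s x - J s y| <= `|x - y|.
Proof.
move=> s0; have := resolvent_firm x y s0; rewrite hdot => h.
have := le_trans h (dot_le_norm hdot _ _).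
have [->|n0] := eqVneq `|J s x - J s y| 0; first by rewrite normr_ge0.
by rewrite expr2 ler_pM2l// lt_def n0 normr_ge0.
Qed.

Lemma resolvent_zero s p : 0 < s -> zeros A p -> J s p = p.
Proof.
move=> s0 p0; have := hA.1 _ _ _ _ (resolventP p s0) p0.
rewrite subr0 -opprB dotNl dotZr hdot oppr_ge0 pmulr_rle0 ?invr_gt0//.
by rewrite exprn_even_le0//= normr_eq0 subr_eq0 => /eqP.
Qed.

(** Monotonicity applied to the two resolvents of the same point, combined with
    the Cauchy-Schwarz inequality, factors into this product; it implies that
    [|x - J_s x|] does not decrease and [|x - J_s x| / s] does not increase
    with [s]. *)
Lemma resolvent_residual_cross s t x : 0 < s -> 0 < t ->
  0 <= (`|x - J t x| - `|x - J s x|) * (t * `|x - J s x| - s * `|x - J t x|).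
Proof.
move=> s0 t0; have := hA.1 _ _ _ _ (resolventP x s0) (resolventP x t0).
have -> : J s x - J t x = (x - J t x) - (x - J s x).
  by rewrite opprB [RHS]addrC addrA subrK.
move: (x - J s x) (x - J t x) => X Y.
have : dot Y X <= `|Y| * `|X| by exact: dot_le_norm.
rewrite !dotE !hdot (dotC X Y) => h1 h2.
have st : 0 < s * t by rewrite mulr_gt0.
have e1 : (s * t) * (s^-1 * dot Y X - s^-1 * `|X| ^+ 2 -
    (t^-1 * `|Y| ^+ 2 - t^-1 * dot Y X)) =
    t * dot Y X - t * `|X| ^+ 2 - s * `|Y| ^+ 2 + s * dot Y X.
  by field; rewrite !gt_eqF.
have : 0 <= t * dot Y X - t * `|X| ^+ 2 - s * `|Y| ^+ 2 + s * dot Y X.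
  by rewrite -e1 mulr_ge0 ?(ltW st)//; lra.
have : s * dot Y X <= s * (`|Y| * `|X|) by rewrite ler_pM2l.
have : t * dot Y X <= t * (`|Y| * `|X|) by rewrite ler_pM2l.
lra.
Qed.

Lemma resolvent_residual_mono s t x : 0 < s -> s <= t ->
  `|x - J s x| <= `|x - J t x|.
Proof.
move=> s0 st; have t0 := lt_le_trans s0 st.
have := resolvent_residual_cross x s0 t0.
have [//|h] := leP `|x - J s x| `|x - J t x|.
rewrite nmulr_rge0 ?subr_lt0// subr_le0 leNgt.
by rewrite (lt_le_trans (y := s * `|x - J s x|)) ?ltr_pM2l ?ler_wpM2r.
Qed.

Lemma resolvent_residual_ratio s t x : 0 < s -> s <= t ->
  s * `|x - J t x| <= t * `|x - J s x|.
Proof.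
move=> s0 st; have t0 := lt_le_trans s0 st.
have := resolvent_residual_cross x s0 t0.
have := resolvent_residual_mono x s0 st; rewrite le_eqVlt => /orP[/eqP->|h].
  by rewrite ler_wpM2r.
by rewrite pmulr_rge0 ?subr_gt0// subr_ge0.
Qed.
End MaximalMonotone.

Lemma normD_sq x y : `|x + y| ^+ 2 = `|x| ^+ 2 + 2 * dot x y + `|y| ^+ 2.
Proof. by rewrite -!hdot !dotE (dotC y x); ring. Qed.

Lemma normB_sq x y : `|x - y| ^+ 2 = `|x| ^+ 2 - 2 * dot x y + `|y| ^+ 2.
Proof. by rewrite normD_sq dotNr normrN mulrN. Qed.

Lemma norm_mix_sq t x y : `|t *: x + (1 - t) *: y| ^+ 2 =
  t * `|x| ^+ 2 + (1 - t) * `|y| ^+ 2 - t * (1 - t) * `|x - y| ^+ 2.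
Proof. by rewrite -!hdot !dotE (dotC y x); ring. Qed.

(** Convex combinations of approximate fixed points are approximate fixed
    points: [T w] is almost as close to [x] and to [y] as [w] is, and in a
    Hilbert space the two distances determine a point of the segment. *)
Lemma nonexp_residual_mix (T : H -> H) t x y (e d : R) :
  (forall a b, `|T a - T b| <= `|a - b|) -> 0 <= t <= 1 ->
  `|x - y| <= d -> `|T x - x| <= e -> `|T y - y| <= e ->
  `|T (t *: x + (1 - t) *: y) - (t *: x + (1 - t) *: y)| ^+ 2 <= d * e + e ^+ 2.
Proof.
move=> nT t01 xyd xe ye; set w := t *: x + _.
have /andP[ht t1] := t01; have ht' : 0 <= 1 - t by rewrite subr_ge0.
have e0 : 0 <= e by apply: le_trans xe.
have d0 : 0 <= d by apply: le_trans xyd.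
have wx : `|T w - x| <= (1 - t) * `|x - y| + e.
  have -> : T w - x = (T w - T x) + (T x - x) by rewrite addrA subrK.
  rewrite (le_trans (ler_normD _ _))// lerD// (le_trans (nT _ _))//.
  have -> : w - x = (1 - t) *: (y - x).
    by rewrite /w addrAC addrC scalerBr -scaleNr opprB [(t - 1) *: x]scalerBl scale1r.
  by rewrite normrZ (ger0_norm ht') distrC.
have wy : `|T w - y| <= t * `|x - y| + e.
  have -> : T w - y = (T w - T y) + (T y - y) by rewrite addrA subrK.
  rewrite (le_trans (ler_normD _ _))// lerD// (le_trans (nT _ _))//.
  have -> : w - y = t *: (x - y).
    by rewrite /w scalerBr scalerBl scale1r -addrA [y - _ - _]addrAC subrr add0r.
  by rewrite normrZ (ger0_norm ht).
have -> : T w - w = t *: (T w - x) + (1 - t) *: (T w - y).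
  by rewrite !scalerBr addrACA -scalerDl subrKC scale1r -opprD.
rewrite norm_mix_sq.
have -> : T w - x - (T w - y) = y - x by rewrite opprB [LHS]addrC addrA subrK.
rewrite (distrC y x); move: wx wy xyd; set X := `|_|; set Z := `|_|; set Y := `|_|.
move=> wx wy xyd.
have Z0 : 0 <= Z by exact: normr_ge0.
have X0 : 0 <= X by exact: normr_ge0.
have Y0 : 0 <= Y by exact: normr_ge0.
have X2 : X ^+ 2 <= ((1 - t) * Z + e) ^+ 2.
  by rewrite ler_sqr ?nnegrE// addr_ge0 ?mulr_ge0.
have Y2 : Y ^+ 2 <= (t * Z + e) ^+ 2.
  by rewrite ler_sqr ?nnegrE// addr_ge0 ?mulr_ge0.
have tX := ler_wpM2l ht X2.
have tY := ler_wpM2l ht' Y2.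
have t4 : t * (1 - t) <= 4^-1.
  by have := sqr_ge0 (t - 2^-1); rewrite sqrrB; lra.
have Ze : 0 <= Z * e by rewrite mulr_ge0.
have Zd : Z * e <= d * e by rewrite ler_wpM2r.
have tZ := ler_wpM2r Ze t4.
have E : t * ((1 - t) * Z + e) ^+ 2 + (1 - t) * (t * Z + e) ^+ 2
  - t * (1 - t) * Z ^+ 2 = 4 * (t * (1 - t) * (Z * e)) + e ^+ 2 by ring.
move: tX tY tZ E; set a := t * X ^+ 2; set b := (1 - t) * Y ^+ 2.
set aa := t * (_ ^+ 2); set bb := (1 - t) * (_ ^+ 2).
set cc := t * (1 - t) * Z ^+ 2; set dd := t * (1 - t) * (Z * e).
lra.
Qed.

End Resolvent.

(** * Approximate projection onto the fixed points *)

Section ApproximateProjection.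
Context (R : realType) (H : completeNormedModType R).
Context (dot : {dot H for (idfun : R -> R)}).
Hypothesis hdot : inner_product dot.
Context (T : H -> H) (p u : H) (D : nat).
Hypothesis nT : forall a b, `|T a - T b| <= `|a - b|.
Hypothesis Tp : T p = p.
Hypothesis D0 : (0 < D)%N.
Hypothesis uD : 2 * `|u - p| <= D%:R.

Local Notation in_ball q := (`|q - p| <= D%:R).
Local Notation approx_fixed q n := (`|T q - q| <= n.+1%:R^-1).

(** If every candidate at every level could be improved by [eta], starting from
    the exact fixed point [p] and going down the levels would make
    [|u - q|^2 <= D^2 / 4] negative after [N] improvements. *)
Lemma approx_projection_descent (W : nat -> nat) (eta : R) (N : nat) :
  0 <= eta -> D%:R ^+ 2 / 4 < N%:R * eta ->
  exists2 i, (i < N)%N & exists q : H, [/\ in_ball q, approx_fixed q (W i.+1) &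
    forall q', in_ball q' -> approx_fixed q' (W i) ->
      `|u - q| ^+ 2 <= `|u - q'| ^+ 2 + eta].
Proof.
move=> eta0 hN; apply: contrapT => hno.
have step i q : (i < N)%N -> in_ball q -> approx_fixed q (W i.+1) ->
    exists q', [/\ in_ball q', approx_fixed q' (W i) &
      `|u - q'| ^+ 2 < `|u - q| ^+ 2 - eta].
  move=> iN qB qW; apply: contrapT => hq; apply: hno; exists i => //; exists q.
  split=> // q' q'B q'W; rewrite leNgt; apply/negP => h.
  by apply: hq; exists q'; split=> //; rewrite ltrBrDr.
have desc m : (m <= N)%N -> exists q, [/\ in_ball q, approx_fixed q (W (N - m)%N) &
    `|u - q| ^+ 2 <= D%:R ^+ 2 / 4 - m%:R * eta].
  elim: m => [_|m IH mN].
    exists p; split; first by rewrite subrr normr0.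
      by rewrite Tp subrr normr0 invr_ge0.
    rewrite mul0r subr0.
    have : `|u - p| ^+ 2 <= (D%:R / 2) ^+ 2.
      by rewrite ler_sqr ?nnegrE ?divr_ge0//; move: uD; lra.
    by move/le_trans; apply; lra.
  have [q [qB qW qu]] := IH (ltnW mN).
  have iN : (N - m.+1 < N)%N by lia.
  have [|q' [q'B q'W q'u]] := step _ q iN qB; first by rewrite subnSK.
  exists q'; split=> //; apply/ltW/(lt_le_trans q'u).
  by rewrite -[m.+1%:R]natr1 mulrDl mul1r; lra.
have [q [_ _]] := desc N (leqnn N).
by have := sqr_ge0 `|u - q|; lra.
Qed.

Lemma w_ge g m : (24 * D * (m + 1) ^ 2 <= w D g m)%N /\
  (g (24 * D * (m + 1) ^ 2) <= w D g m)%N.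
Proof. by split; rewrite /w leq_max leqnn ?orbT. Qed.

(** The descent is run along the levels [W i], the iterates of [w] from [0].  A
    point [q] near-optimal among the approximate fixed points of level [W i]
    can be compared with [q + t (q' - q)], which has that level if [q'] and
    [q] are fixed up to [1/(24 D (W i + 1)^2 + 1)]. *)
Lemma approx_projection (j : nat) (g : nat -> nat) :
  exists2 N, (N <= beta D j g)%N & exists q : H, [/\ in_ball q,
    approx_fixed q (g N) &
    forall q', in_ball q' -> approx_fixed q' N ->
      dot (u - q) (q' - q) <= j.+1%:R^-1].
Proof.
pose d : R := D%:R; pose J : R := j.+1%:R.
have d1 : 1 <= d by rewrite ler1n.
have J1 : 1 <= J by rewrite ler1n.
have dJ0 : 0 < d ^+ 2 * J by rewrite mulr_gt0 ?exprn_gt0//; lra.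
pose W i := iter i (w D g) 0%N.
pose eta : R := (8 * (d * J) ^+ 2)^-1.
have dj2 : 0 < 8 * (d * J) ^+ 2 by rewrite mulr_gt0// exprn_gt0// mulr_gt0//; lra.
have eta0 : 0 < eta by rewrite invr_gt0.
have [||i iN [q [qB qW qu]]] :=
  @approx_projection_descent W eta (4 * D ^ 4 * (j + 1) ^ 2).
- exact: ltW.
- rewrite addn1 !(natrX, natrM) -/d -/J.
  have -> : 4 * d ^+ 4 * J ^+ 2 * eta = d ^+ 2 / 2.
    by rewrite /eta; field; rewrite !gt_eqF//; lra.
  have : 0 < d ^+ 2 by rewrite exprn_gt0//; lra.
  lra.
pose m := W i; pose N := (24 * D * (m + 1) ^ 2)%N.
have [wN wg] := w_ge g m.
have weak a n n' : (n <= n')%N -> a <= n'.+1%:R^-1 -> a <= n.+1%:R^-1 :> R.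
  by move=> nn' /le_trans; apply; rewrite lef_pV2 ?posrE ?ltr0n// ler_nat.
exists N.
  rewrite /beta /N leq_mul// leq_exp2r// leq_add2r /m.
  have Wmono a b : (W a <= W (b + a))%N.
    elim: b => // b IH; rewrite addSn; apply: leq_trans IH _; rewrite [leqRHS]iterS.
    apply: leq_trans (w_ge g _).1; rewrite -/(W (b + a)%N).
    have : (W (b + a)%N + 1 <= (W (b + a)%N + 1) ^ 2)%N by rewrite -mulnn leq_pmulr// addn1.
    by move: (_ ^ 2)%N => X; nia.
  by have := Wmono i (4 * D ^ 4 * (j + 1) ^ 2 - i)%N; rewrite subnK// ltnW.
exists q; split=> //.
  exact: weak qW.
move=> q' q'B q'N.
(* Comparison with the point at parameter [t] gives
   [2 <u - q, q' - q> <= 4 d^2 t + eta / t]; this [t] makes the first term [1/J]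
   and the second [1/(2J)]. *)
pose t : R := (4 * d ^+ 2 * J)^-1.
have t0 : 0 < t by rewrite invr_gt0; lra.
have tdJ : t * (d ^+ 2 * J) = 4^-1.
  by rewrite /t; field; rewrite !gt_eqF//; lra.
have t1 : 0 <= t <= 1.
  rewrite (ltW t0)/= /t invf_le1; last lra.
  have : 1 <= d ^+ 2 by rewrite exprn_ege1.
  nra.
have qN : approx_fixed q N by apply: weak qW.
have d2 : `|q' - q| <= 2 * d.
  have -> : q' - q = (q' - p) - (q - p) by rewrite opprB addrA subrK.
  by rewrite (le_trans (ler_normB _ _))//; move: qB q'B; rewrite -/d; lra.
pose qt := t *: q' + (1 - t) *: q.
have qtB : in_ball qt.
  have -> : qt - p = t *: (q' - p) + (1 - t) *: (q - p).
    by rewrite !scalerBr addrACA -opprD -scalerDl subrKC scale1r.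
  rewrite (le_trans (ler_normD _ _))// !normrZ !ger0_norm; try lra.
  by move: qB q'B; rewrite -/d => qB q'B; nra.
have qtW : approx_fixed qt m.
  have := nonexp_residual_mix hdot nT t1 d2 q'N qN; rewrite -/qt => h.
  pose M : R := m.+1%:R.
  have M1 : 1 <= M by rewrite ler1n.
  have NE : N.+1%:R = 24 * d * M ^+ 2 + 1.
    by rewrite -[LHS]natr1 /N addn1 !(natrX, natrM).
  have dM : 1 <= d * M ^+ 2 by rewrite mulr_ege1// exprn_ege1.
  rewrite -/M -[_ <= _](@ler_pXn2r _ 2%N) ?nnegrE ?invr_ge0//.
  apply: (le_trans h); rewrite NE [leRHS]exprVn.
  have e0 : 0 < 24 * d * M ^+ 2 + 1 by lra.
  have e1 : (24 * d * M ^+ 2 + 1)^-1 <= (24 * d * M ^+ 2)^-1.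
    by rewrite lef_pV2 ?posrE; lra.
  have e2 : (24 * d * M ^+ 2 + 1)^-1 <= 24^-1.
    by rewrite lef_pV2 ?posrE; lra.
  have e3 : 0 < (24 * d * M ^+ 2 + 1)^-1 by rewrite invr_gt0.
  have E : d * (24 * d * M ^+ 2)^-1 = 24^-1 * (M ^+ 2)^-1.
    by field; rewrite !gt_eqF//; lra.
  have h3 : d * (24 * d * M ^+ 2 + 1)^-1 <= 24^-1 * (M ^+ 2)^-1.
    by rewrite -E ler_wpM2l//; lra.
  have h4 : 1 * (24 * d * M ^+ 2 + 1)^-1 <= d * (24 * d * M ^+ 2 + 1)^-1.
    by rewrite ler_wpM2r// ltW.
  have h5 : (24 * d * M ^+ 2 + 1)^-1 ^+ 2 <= (24 * d * M ^+ 2 + 1)^-1 * 24^-1.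
    by rewrite expr2 ler_wpM2l// ltW.
  have M2 : 0 < (M ^+ 2)^-1 by rewrite invr_gt0 exprn_gt0//; lra.
  move: h3 h4 h5 M2 e3; clear; move: (24 * d * _ + 1)^-1 (M ^- 2) => X V.
  rewrite -!mulrA; move: (d * X) (X ^+ 2) => Y Z; lra.
have := qu _ qtB qtW.
have -> : u - qt = (u - q) - t *: (q' - q).
  by rewrite /qt scalerBl scale1r scalerBr -[RHS]addrA -opprD addrCA.
rewrite [X in _ <= X + _](normB_sq hdot) dotZr normrZ exprMn (ger0_norm (ltW t0)).
have : `|q' - q| ^+ 2 <= (2 * d) ^+ 2 by rewrite ler_sqr ?nnegrE//; lra.
move: (dot _ _) (`|q' - q| ^+ 2) => P Q hQ hP.
have etaE : eta = t * (2 * J)^-1.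
  by rewrite /eta /t; field; rewrite !gt_eqF//; lra.
have tQ : t ^+ 2 * Q <= t * J^-1.
  have -> : J^-1 = t * (2 * d) ^+ 2.
    by rewrite /t; field; rewrite !gt_eqF//; lra.
  by rewrite expr2 -mulrA !ler_pM2l.
have etaE' : eta = 2^-1 * (t * J^-1) by rewrite etaE invfM mulrCA.
have : t * (2 * P) <= t * (3/2 * J^-1).
  rewrite mulrCA [leRHS]mulrCA; move: hP tQ; rewrite etaE'.
  by move: (t * J^-1) (t ^+ 2 * Q) (t * P) (`|u - q| ^+ 2) => a b a' b'; lra.
have Ji : 0 < J^-1 by rewrite invr_gt0; lra.
rewrite (ler_pM2l t0) -/J; move: Ji; move: J^-1 => K; lra.
Qed.
End ApproximateProjection.

(** * Sequences of real numbers *)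

Section Metastability.
Context (R : realType).
Implicit Types (s : nat -> R) (g : nat -> nat).
Local Open Scope nat_scope.

Lemma monotone_funP g : monotone_fun g -> {homo g : m n / m <= n}.
Proof.
move=> hg m n /subnK <-; elim: (n - m) => // d IH.
by rewrite addSn (leq_trans IH).
Qed.

Lemma iter_le_arg g i n m : {homo g : m n / m <= n} ->
  n <= m -> iter i g n <= iter i g m.
Proof. by move=> hg nm; elim: i => // i; rewrite !iterS => /hg. Qed.

Lemma iter_nondecreasing g n : {homo g : m n / m <= n} -> n <= g n ->
  {homo (fun i => iter i g n) : i j / i <= j}.
Proof.
move=> hg ng i j /subnK <-; rewrite addnC iterD.
apply: iter_le_arg => //; elim: (j - i) => // d IH.
by rewrite iterS (leq_trans ng)// hg.
Qed.

Lemma iter_nonincreasing g i n : {homo g : m n / m <= n} -> g n <= n ->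
  iter i g n <= n.
Proof. by move=> hg gn; elim: i => // i /hg /leq_trans; apply. Qed.

(** If [g n < n] the iterates decrease and the maximum in [phi2] is [n] itself;
    otherwise they increase, with the number of iterations too. *)
Lemma phi2_le D j j' n n' g : {homo g : m n / m <= n} ->
  j <= j' -> n <= n' -> phi2 D j n g <= phi2 D j' n' g.
Proof.
move=> hg jj nn; rewrite /phi2 geq_max !leq_max nn/=.
have [ng|/ltnW gn] := leqP n (g n).
  apply/orP; right; apply: leq_trans (iter_le_arg _ hg nn).
  by apply: iter_nondecreasing => //; rewrite leq_mul// leq_add2r.
by rewrite (leq_trans (iter_nonincreasing _ hg gn) nn).
Qed.

(** Among [4 D^2 (j+1)] consecutive differences whose sum is at most [4 D^2],
    one is at most [1/(j+1)]. *)
Lemma phi2_metastable D j n g s : 0 < D ->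
  {homo g : m n / m <= n} -> n <= g n ->
  (forall i, 0 <= s i <= (4 * D ^ 2)%:R)%R ->
  exists m, [/\ n <= m, m <= phi2 D j n g, m <= g m &
    (s m - s (g m) <= j.+1%:R^-1)%R].
Proof.
move=> D0 hg ng sD; pose K := 4 * D ^ 2 * (j + 1).
have K0 : 0 < K by rewrite !(expn_gt0, muln_gt0) D0 addn1.
have itmono := iter_nondecreasing hg ng.
suff [i iK hi] : exists2 i, i < K &
    (s (iter i g n) - s (iter i.+1 g n) <= j.+1%:R^-1)%R.
  exists (iter i g n); split=> //.
  - exact: (itmono 0).
  - by rewrite /phi2 leq_max; apply/orP; right; apply: itmono; apply: ltnW.
  - exact: (itmono i i.+1).
apply: contrapT => hno.
have drop i : i <= K -> (s (iter i g n) + i%:R * j.+1%:R^-1 <= s n)%R /\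
    ((0 < i)%N -> s (iter i g n) + i%:R * j.+1%:R^-1 < s n)%R.
  elim: i => [_|i IH iK]; first by rewrite mul0r addr0.
  have [h _] := IH (ltnW iK).
  have h' : (j.+1%:R^-1 < s (iter i g n) - s (iter i.+1 g n))%R.
    by rewrite ltNge; apply/negP => hh; apply: hno; exists i.
  rewrite -[(i.+1)%:R%R]natr1 mulrDl mul1r.
  move: h h'; rewrite iterS.
  move: (s (iter i g n)) (s (g _)) (s n) (j.+1%:R^-1)%R (i%:R / j.+1%:R)%R.
  by move=> a b c e f; split=> *; lra.
have [_ /(_ K0)] := drop K (leqnn K).
have -> : (K%:R * j.+1%:R^-1 = (4 * D ^ 2)%:R :> R)%R.
  by rewrite /K addn1 natrM mulfK// pnatr_eq0.
have /andP[_] := sD n; have /andP[] := sD (iter K g n); lra.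
Qed.

(** Take for [t] the last index up to [i] at which [s] increases: from [t.+1]
    to [i] the sequence does not increase. *)
Lemma last_increase s a b i : a <= b -> b <= i -> (s b < s b.+1)%R ->
  exists2 t, a <= t <= i & (s t < s t.+1)%R /\ (s i <= s t.+1)%R.
Proof.
move=> ab /subnK <- sb; elim: (i - b) => [|d [t /andP[at_ ti] [st si]]].
  by exists b; rewrite ?ab ?leqnn// ltW.
have [h|h] := ltP (s (d + b)) (s (d + b).+1); last first.
  exists t; first by rewrite at_ addSn ltnW.
  by split=> //; apply: le_trans si.
exists (d + b); last by [].
by rewrite (leq_trans ab) ?leq_addl//= addSn.
Qed.

Local Open Scope ring_scope.

(** The bound [b] is a fixed point of the recurrence without its error term;
    what exceeds [b] is contracted by [1 - lam i <= expR (- lam i)] at each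
    step, while the errors add up. *)
Lemma halpern_recurrence_bound s (lam : nat -> R) (b e : R) (m M : nat) :
  0 <= b -> 0 <= e -> (forall i, 0 <= s i) -> (forall i, 0 < lam i < 1) ->
  (forall i, (m <= i < M)%N -> s i.+1 <= (1 - lam i) * s i + lam i * b + e) ->
  forall i, (m <= i <= M)%N ->
    s i <= expR (- \sum_(m <= j < i) lam j) * s m + b + (i - m)%:R * e.
Proof.
move=> b0 e0 s0 lam01 rec i /andP[/subnK <-].
elim: (i - m)%N => [_|d IH dM].
  by rewrite add0n big_geq// oppr0 expR0 mul1r subnn mul0r addr0 lerDl.
have dm : (m <= d + m)%N by rewrite leq_addl.
have /(_ (ltnW dM)) := IH; have := rec (d + m)%N; rewrite dm => /(_ dM).
rewrite addSn big_nat_recr//= opprD expRD subSn// -[_.+1%:R]natr1.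
have /andP[l0 l1] := lam01 (d + m)%N.
have := expR_ge1Dx (- lam (d + m)%N); move: (lam _) l0 l1 => l l0 l1 el.
set E := expR (- \sum_(_ <= _ < _) _); set x := s (d + m)%N; set x' := s _.+1.
set n : R := (d + m - m)%:R => h1 h2.
have n0 : 0 <= n by [].
have E0 : 0 <= E * s m by rewrite mulr_ge0 ?expR_ge0.
have l1' : 0 <= 1 - l by lra.
have h3 := ler_wpM2l l1' h2.
have h4 := ler_wpM2l E0 el.
have ne : 0 <= l * (n * e) by rewrite !mulr_ge0// ltW.
rewrite mulrAC mulrDl mul1r; move: h4 h3 h1 ne.
by move: (expR _) (E * s m) (n * e) => X Y Z; lra.
Qed.

End Metastability.

(** * The iteration *)

Section ProximalPoint.
Context (R : realType) (H : completeNormedModType R).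
Context (dot : {dot H for (idfun : R -> R)}).
Hypothesis hdot : inner_product dot.
Context (A : H -> set H).
Hypothesis hA : maximal_monotone dot A.
Context (u p : H) (cs lambda gamma delta : nat -> R) (y : nat -> H).
Hypothesis hcs : forall n, 0 < cs n.
Hypothesis hlambda : forall n, 0 < lambda n < 1.
Hypothesis hdelta : forall n, 0 < delta n < 1.
Hypothesis hgamma : forall n, 0 <= gamma n < 1.
Hypothesis hsum : forall n, lambda n + gamma n + delta n = 1.
Hypothesis hy : forall n, y n.+1 =
  lambda n *: u + gamma n *: y n + delta n *: resolvent A (cs n) (y n).
Hypothesis hp : zeros A p.
Context (D : nat).
Hypothesis D0 : (0 < D)%N.
Hypothesis uD : 2 * `|u - p| <= D%:R.
Hypothesis y0D : `|y 0%N - p| <= D%:R.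

Local Notation J i := (resolvent A (cs i)).
Local Notation dotE := (@dotE R H dot).
Local Notation dotC := (@dotC R H dot).
Local Notation in_ball q := (`|q - p| <= D%:R).

Lemma resolvent_in_ball i q : in_ball q -> in_ball (J i q).
Proof.
by move=> qB; rewrite -{1}(resolvent_zero hdot hA (hcs i) hp)
  (le_trans (resolvent_nonexp hdot hA q p (hcs i))).
Qed.

Lemma affine_combB (l g d : R) (a b x q : H) : l + g + d = 1 ->
  l *: a + g *: b + d *: x - q = l *: (a - q) + g *: (b - q) + d *: (x - q).
Proof.
move=> lgd; rewrite !scalerBr [X in _ = X + _]addrACA [RHS]addrACA.
by rewrite -!opprD -!scalerDl lgd scale1r.
Qed.

Lemma iterates_in_ball n : in_ball (y n).
Proof.
elim: n => // n IH; have JB := resolvent_in_ball n IH.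
have -> : y n.+1 - p = lambda n *: (u - p) + gamma n *: (y n - p)
    + delta n *: (J n (y n) - p).
  by rewrite hy affine_combB.
have /andP[l0 _] := hlambda n; have /andP[d0 _] := hdelta n.
have /andP[g0 _] := hgamma n; have sm := hsum n.
rewrite (le_trans (ler_normD _ _))// (le_trans (lerD (ler_normD _ _) (lexx _)))//.
rewrite !normrZ (gtr0_norm l0) (ger0_norm g0) (gtr0_norm d0).
have uB : `|u - p| <= D%:R by apply: le_trans uD; rewrite ler_peMl// ler1n.
have -> : D%:R = lambda n * D%:R + gamma n * D%:R + delta n * D%:R.
  by rewrite -!mulrDl sm mul1r.
by rewrite !lerD// ler_wpM2l// ltW.
Qed.

Lemma in_ball_dist q q' : in_ball q -> in_ball q' -> `|q' - q| <= 2 * D%:R.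
Proof.
move=> qB q'B; have -> : q' - q = (q' - p) - (q - p) by rewrite opprB addrA subrK.
by rewrite (le_trans (ler_normB _ _))//; lra.
Qed.

Lemma anchor_dist q : in_ball q -> `|u - q| <= 3 / 2 * D%:R.
Proof.
move=> qB; have -> : u - q = (u - p) - (q - p) by rewrite opprB addrA subrK.
rewrite (le_trans (ler_normB _ _))//; move: uD qB.
  move: `|u - p| `|q - p| => a b h1 h2. lra.
Qed.

Local Notation sq q i := (`|y i - q| ^+ 2).

Lemma sq_le q i : in_ball q -> sq q i <= 4 * D%:R ^+ 2.
Proof.
move=> qB; have := in_ball_dist qB (iterates_in_ball i).
have -> : 4 * D%:R ^+ 2 = (2 * D%:R) ^+ 2 :> R by ring.
by rewrite ler_sqr ?nnegrE.
Qed.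

Lemma anchor_dot_le q q' : in_ball q -> in_ball q' ->
  dot (u - q) (q' - q) <= 3 * D%:R ^+ 2.
Proof.
move=> qB q'B; rewrite (le_trans (dot_le_norm hdot _ _))//.
have -> : 3 * D%:R ^+ 2 = (3 / 2 * D%:R) * (2 * D%:R) :> R by field.
by rewrite ler_pM//; [exact: anchor_dist|exact: in_ball_dist].
Qed.

(** Firm nonexpansiveness of [J_i] between [y i] and [q], where [J_i q] may
    differ from [q] by [eps].  The error is [2 <2b - a, v>] with
    [a = y_i - q], [b = J_i y_i - q] and [v = J_i q - q], and
    [|2b - a| <= 6 D]. *)
Lemma approx_resolvent_firm q i (eps : R) : in_ball q -> `|J i q - q| <= eps ->
  `|J i (y i) - q| ^+ 2 <=
    sq q i - `|y i - J i (y i)| ^+ 2 + 12 * D%:R * eps.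
Proof.
move=> qB qe; have yB := iterates_in_ball i; have JB := resolvent_in_ball i yB.
have := resolvent_firm hdot hA (y i) q (hcs i).
pose a := y i - q; pose b := J i (y i) - q; pose v := J i q - q.
have -> : J i (y i) - J i q = b - v by rewrite /b /v opprB addrA subrK.
have -> : y i - J i (y i) = a - b by rewrite /a /b opprB addrA subrK.
have aN : `|a| <= 2 * D%:R by exact: in_ball_dist.
have bN : `|b| <= 2 * D%:R by exact: in_ball_dist.
have vN : `|v| <= eps by [].
have hv : dot (2 *: b - a) v <= (6 * D%:R) * eps.
  rewrite (le_trans (dot_le_norm hdot _ _))// ler_pM//.
  rewrite (le_trans (ler_normB _ _))// normrZ ger0_norm//; lra.
rewrite -/a -/b; move: hv; have := dot_ge0 hdot v.
rewrite -!hdot; move: a b v {aN bN vN} => a b v.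
rewrite !dotE (dotC v b) (dotC b a) (dotC v a); lra.
Qed.

(** Expanding the square of [y_{i+1} - q], a combination of [u - q], [y_i - q]
    and [J_i y_i - q] with weights [lambda], [gamma] and [delta]: the last two
    weights sum to [1 - lambda >= delta], which is why the residual comes with
    the factor [delta^2]. *)
Lemma key_recurrence q i (eps : R) : in_ball q -> `|J i q - q| <= eps ->
  sq q i.+1 + delta i ^+ 2 * `|y i - J i (y i)| ^+ 2 <=
    (1 - lambda i) * sq q i + 2 * lambda i * dot (u - q) (y i.+1 - q)
    + 12 * D%:R * eps.
Proof.
move=> qB qe; have := approx_resolvent_firm qB qe.
have e0 : 0 <= 12 * D%:R * eps by rewrite mulr_ge0// (le_trans _ qe).
move: e0; move: (12 * _ * _) => e e0.
have /andP[l0 l1] := hlambda i; have /andP[d0 d1] := hdelta i.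
have /andP[g0 g1] := hgamma i.
pose a := y i - q; pose b := J i (y i) - q; pose x := u - q.
have -> : y i - J i (y i) = a - b by rewrite /a /b opprB addrA subrK.
have -> : y i.+1 - q = lambda i *: x + gamma i *: a + delta i *: b.
  by rewrite hy affine_combB.
have gE : gamma i = 1 - lambda i - delta i by rewrite -(hsum i); ring.
rewrite -/a -/b -/x -!hdot; move: g0 g1; rewrite gE.
move: (lambda i) (delta i) l0 l1 d0 d1 => l d l0 l1 d0 d1 g0 g1.
move: a b x => a b x.
set Q := dot (a - b) (a - b); have Q0 : 0 <= Q by exact: dot_ge0.
have a0 : 0 <= dot a a by exact: dot_ge0.
have x0 : 0 <= dot x x by exact: dot_ge0.
have -> : dot (l *: x + (1 - l - d) *: a + d *: b)
  (l *: x + (1 - l - d) *: a + d *: b) =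
  (1 - l) * ((1 - l - d) * dot a a + d * dot b b) - (1 - l - d) * d * Q
  + 2 * l * dot x (l *: x + (1 - l - d) *: a + d *: b) - l ^+ 2 * dot x x.
  rewrite /Q !dotE (dotC b a) (dotC a x) (dotC b x); ring.
move: (dot x (_ + _)) => X; move: a0 x0 Q0.
move: (dot a a) (dot b b) (dot x x) Q => aa bb xx Q a0 x0 Q0 hb.
have ld : 0 <= (1 - l) * d by rewrite mulr_ge0; lra.
have h1 := ler_wpM2l ld hb.
have h2 : 0 <= l ^+ 2 * xx by rewrite mulr_ge0// sqr_ge0.
have h3 : 0 <= (1 - l) * l * aa by rewrite !mulr_ge0//; lra.
have h4 : 0 <= (1 - l - d) * d * Q by rewrite !mulr_ge0//; lra.
have h5 : (1 - l) * d * e <= 1 * e.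
  by rewrite ler_wpM2r// mulr_ile1//; lra.
have h6 : 0 <= (1 - l - d) * d * Q by rewrite !mulr_ge0//; lra.
lra.
Qed.


Context (c : nat) (Cb h ell L : nat -> nat).
Hypothesis hc : (0 < c)%N.
Hypothesis hell : {homo ell : m n / (m <= n)%N}.
Hypothesis h1 : forall n, (h n)%:R^-1 <= lambda n.
Hypothesis h2 : forall k n : nat, (ell k <= n)%N -> lambda n <= k.+1%:R^-1.
Hypothesis h3 : forall k : nat, k%:R <= \sum_(1 <= i < (L k).+1) lambda i.
Hypothesis h4 : forall n, c%:R^-1 <= Num.min (cs n) (delta n ^+ 2).
Hypothesis hcsCb : forall n, cs n <= (Cb n)%:R.
Hypothesis hCb : {homo Cb : m n / (m <= n)%N}.

Local Notation T := (resolvent A c%:R^-1).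

Lemma base_residual_le i x : `|T x - x| <= `|x - J i x|.
Proof.
rewrite distrC; apply: (resolvent_residual_mono hdot hA).
  by rewrite invr_gt0 ltr0n.
by have := h4 i; rewrite le_min => /andP[].
Qed.

(** The function [zeta] converts the residual for the parameter [1/c] into
    residuals for all [c_i], [i <= n]: the residual divided by the parameter
    does not increase, and [c_i <= Cb n]. *)
Lemma zeta_residual_le q j n i :
  `|T q - q| <= (zeta c Cb j n).+1%:R^-1 -> (i <= n)%N ->
  `|J i q - q| <= j.+1%:R^-1.
Proof.
move=> hq in_; have c0 : 0 < c%:R :> R by rewrite ltr0n.
have Cb0 : (0 < Cb n)%N.
  by rewrite -(ltr0n R); apply: lt_le_trans (hcsCb n).
have csn : cs i <= (Cb n)%:R by rewrite (le_trans (hcsCb i))// ler_nat hCb.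
have zE : (zeta c Cb j n).+1 = (c * j.+1 * Cb n)%N.
  by rewrite /zeta addn1 subn1 prednK// !muln_gt0 hc Cb0.
have cc : c%:R^-1 <= cs i by have := h4 i; rewrite le_min => /andP[].
have ci0 : 0 < c%:R^-1 :> R by rewrite invr_gt0.
have := resolvent_residual_ratio hdot hA q ci0 cc.
rewrite !(distrC q) mulrC ler_pdivrMr// => /le_trans; apply.
rewrite zE !natrM in hq.
rewrite (le_trans (ler_wpM2r (ltW c0) (ler_pM (ltW (hcs i)) (normr_ge0 _) csn hq)))//.
move: (j.+1%:R) (ltr0Sn R j) => j1 j0.
have Cb0' : 0 < (Cb n)%:R :> R by rewrite ltr0n.
rewrite (_ : _ * _ * _ = j1^-1) ?lexx//.
by field; rewrite !gt_eqF.
Qed.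

Lemma lambda_le_of_ell N M i : (ell N <= i)%N -> (M <= N.+1)%N ->
  lambda i * M%:R <= 1.
Proof.
move=> /h2 Ni MN; have l0 : 0 <= lambda i by have /andP[/ltW] := hlambda i.
have MN' : M%:R <= N.+1%:R :> R by rewrite ler_nat.
by rewrite (le_trans (ler_pM l0 _ Ni MN'))// mulVf// pnatr_eq0.
Qed.

Lemma lambda_small k N i : (r3 c D ell k N <= i)%N ->
  [/\ lambda i * (96 * c%:R * D%:R ^+ 2 * N.+1%:R ^+ 2) <= 1,
      lambda i * (256 * D%:R ^+ 2 * k.+1%:R ^+ 2) <= 1 &
      lambda i * (16 * c%:R * (r2 D k N)%:R ^+ 2 * D%:R ^+ 2) <= 1].
Proof.
move=> /lambda_le_of_ell hl; split.
- have := hl (96 * c * D ^ 2 * (N + 1) ^ 2)%N; rewrite addn1 !(natrX, natrM).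
  by apply; lia.
- have := hl (256 * D ^ 2 * (k + 1) ^ 2)%N; rewrite addn1 !(natrX, natrM).
  by apply; lia.
- have := hl (16 * c * r2 D k N ^ 2 * D ^ 2)%N; rewrite !(natrX, natrM).
  by apply; lia.
Qed.

Section NearProjection.
Context (k N : nat) (q : H).
Hypothesis qB : in_ball q.
Hypothesis qproj : forall q', in_ball q' -> `|T q' - q'| <= N.+1%:R^-1 ->
  dot (u - q) (q' - q) <= (32 * (k + 1) ^ 2 - 1).+1%:R^-1.

Lemma near_projection_iterate i : `|y i - J i (y i)| <= N.+1%:R^-1 ->
  dot (u - q) (y i - q) <= 32^-1 * (k.+1%:R ^+ 2)^-1.
Proof.
move=> hi; have := qproj (iterates_in_ball i) (le_trans (base_residual_le _ _) hi).
by rewrite subn1 addn1 prednK ?muln_gt0 ?expn_gt0// natrM natrX invfM.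
Qed.

(** When [s] increases at [t], the recurrence bounds the residual at [t] by a
    multiple of [lambda t], which is small.  Hence [y t] is an approximate
    fixed point, [y t.+1] is close to [y t], and [<u - q, y_{t+1} - q>] is
    small.  Replacing [s_t] by [s_{t+1}] in the recurrence and dividing by
    [lambda t] bounds [s_{t+1}]. *)
Lemma increase_bound t (eps : R) : (r3 c D ell k N <= t)%N ->
  sq q t < sq q t.+1 -> `|J t q - q| <= eps ->
  16 * k.+1%:R ^+ 2 * (6 * D%:R + 1) * eps <= lambda t ->
  sq q t.+1 <= k.+1%:R^-1.
Proof.
move=> /lambda_small[_ lk lr] sinc qe heps.
have key := key_recurrence qB qe.
have e0 : 0 <= eps by apply: le_trans qe.
have uq := anchor_dist qB; have uy := anchor_dist (iterates_in_ball t).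
have dot3 := anchor_dot_le qB (iterates_in_ball t.+1).
have s0 : 0 <= sq q t by rewrite sqr_ge0.
have /andP[l0 l1] := hlambda t; have /andP[d0 d1] := hdelta t.
have near := @near_projection_iterate t.
have c1 : 1 <= c%:R :> R by rewrite ler1n.
have D1 : 1 <= D%:R :> R by rewrite ler1n.
have K1 : 1 <= k.+1%:R :> R by rewrite ler1n.
have hd : c%:R^-1 <= delta t ^+ 2 by have := h4 t; rewrite le_min => /andP[].
have rN : N.+1%:R <= (r2 D k N)%:R :> R.
  rewrite ler_nat /r2 leq_max; apply/orP; left.
  by rewrite addn1 leq_pmull.
have rk : 128 * D%:R * k.+1%:R ^+ 2 <= (r2 D k N)%:R :> R.
  by rewrite -natrX -!natrM ler_nat /r2 leq_max !addn1 leqnn orbT.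
have N1 : 1 <= N.+1%:R :> R by rewrite ler1n.
pose V : R := (k.+1%:R ^+ 2)^-1.
have KV : k.+1%:R ^+ 2 * V = 1 by rewrite mulfV// expf_neq0// pnatr_eq0.
have V0 : 0 < V by rewrite invr_gt0 exprn_gt0.
have Vk : V <= k.+1%:R^-1.
  by rewrite lef_pV2 ?posrE ?exprn_gt0//; rewrite expr2 ler_peMl//; lra.
have V1 : V <= 1 by rewrite invf_le1 ?exprn_gt0// exprn_ege1.
have err : 12 * D%:R * eps <= lambda t * V / 8.
  have := ler_wpM2r (ltW V0) heps.
  have -> : 16 * k.+1%:R ^+ 2 * (6 * D%:R + 1) * eps * V =
    16 * (6 * D%:R + 1) * eps * (k.+1%:R ^+ 2 * V) by ring.
  rewrite KV; move: (lambda t * V) => w; lra.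
set X := `|y t - J t (y t)| in key near.
have X0 : 0 <= X by exact: normr_ge0.
(* The inner product contributes [6 lambda D^2] and the error at most
   [lambda V / 8]. *)
have dX : delta t ^+ 2 * X ^+ 2 <= 7 * (lambda t * D%:R ^+ 2).
  have lV : lambda t * V <= lambda t * D%:R ^+ 2.
    by rewrite ler_pM2l// (le_trans V1)// exprn_ege1.
  have ldot := ler_wpM2l (ltW l0) dot3.
  have ls : 0 <= lambda t * sq q t by rewrite mulr_ge0// ltW.
  have lD : 0 <= lambda t * D%:R ^+ 2 by rewrite mulr_ge0 ?sqr_ge0// ltW.
  move: key err ldot ls lV lD sinc; move: (sq q t) (sq q t.+1) => s s'.
  move: (dot _ _) (delta t ^+ 2 * _) (D%:R ^+ 2) (12 * D%:R * eps) (lambda t) => P Y E W l.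
  lra.
have Xr : X * (r2 D k N)%:R <= 1.
  rewrite -[_ <= 1](@ler_pXn2r _ 2%N) ?nnegrE ?mulr_ge0// expr1n exprMn.
  have cX : X ^+ 2 <= c%:R * (7 * (lambda t * D%:R ^+ 2)).
    rewrite -ler_pdivrMl; last lra.
    by apply: le_trans dX; rewrite ler_wpM2r// sqr_ge0.
  have := ler_wpM2r (sqr_ge0 (r2 D k N)%:R) cX.
  have -> : c%:R * (7 * (lambda t * D%:R ^+ 2)) * (r2 D k N)%:R ^+ 2 =
    7/16 * (lambda t * (16 * c%:R * (r2 D k N)%:R ^+ 2 * D%:R ^+ 2)) by field.
  by move: lr; move: (lambda t * _) (X ^+ 2 * _) => w w'; lra.
have Nr : X * N.+1%:R <= 1 by apply: le_trans Xr; rewrite ler_wpM2l.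
have XV : X * D%:R <= V / 128.
  have := le_trans (ler_wpM2l X0 rk) Xr.
  have -> : X * (128 * D%:R * k.+1%:R ^+ 2) = 128 * (k.+1%:R ^+ 2 * (X * D%:R)) by ring.
  move=> /(ler_wpM2l (ltW V0)); rewrite mulr1.
  have -> : V * (128 * (k.+1%:R ^+ 2 * (X * D%:R))) =
    128 * (k.+1%:R ^+ 2 * V) * (X * D%:R) by ring.
  by rewrite KV; move: (X * _) => w; lra.
have lV : lambda t * D%:R ^+ 2 <= V / 256.
  move: lk => /(ler_wpM2l (ltW V0)); rewrite mulr1.
  have -> : V * (lambda t * (256 * D%:R ^+ 2 * k.+1%:R ^+ 2)) =
    256 * (k.+1%:R ^+ 2 * V) * (lambda t * D%:R ^+ 2) by ring.
  by rewrite KV; move: (lambda t * _) => w; lra.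
have nearX : dot (u - q) (y t - q) <= V / 32.
  by rewrite [V / _]mulrC near// -div1r ler_pdivlMr ?ltr0n.
have step : `|y t.+1 - y t| <= 3 / 2 * D%:R * lambda t + X.
  have -> : y t.+1 - y t = lambda t *: (u - y t) + delta t *: (J t (y t) - y t).
    by rewrite hy affine_combB// subrr scaler0 addr0.
  rewrite (le_trans (ler_normD _ _))// !normrZ (gtr0_norm l0) (gtr0_norm d0).
  rewrite (distrC (J t (y t))) -/X [_ * lambda t]mulrC lerD//; last first.
    by rewrite ler_piMl// ltW.
  by rewrite ler_wpM2l// ltW.
have stepdot : dot (u - q) (y t.+1 - y t) <= V / 32.
  rewrite (le_trans (dot_le_norm hdot _ _))//.
  rewrite (le_trans (ler_pM _ _ uq step))//.
  have -> : 3 / 2 * D%:R * (3 / 2 * D%:R * lambda t + X) =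
    9/4 * (lambda t * D%:R ^+ 2) + 3/2 * (X * D%:R) by field.
  move: XV lV; move: (lambda t * _) (X * _) => w w'; lra.
have dotV : dot (u - q) (y t.+1 - q) <= V / 16.
  have -> : y t.+1 - q = (y t.+1 - y t) + (y t - q) by rewrite addrA subrK.
  rewrite dotDr; move: stepdot nearX; move: (dot _ _) (dot _ _) => w w'; lra.
apply: le_trans Vk; rewrite -(ler_pM2l l0).
have ldot := ler_wpM2l (ltW l0) dotV.
have dX0 : 0 <= delta t ^+ 2 * X ^+ 2 by rewrite mulr_ge0 ?sqr_ge0.
have ls : (1 - lambda t) * sq q t <= (1 - lambda t) * sq q t.+1.
  by apply: ler_wpM2l; rewrite ?subr_ge0 ltW.
move: key err ldot ls dX0; move: (sq q t) (sq q t.+1) => s s'.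
move: (delta t ^+ 2 * _) (12 * D%:R * eps) => Y W.
have lV0 : 0 <= lambda t * V by rewrite mulr_ge0// ltW.
move: lV0; move: (dot _ _) (lambda t) => P l; lra.
Qed.

(** The sum of the [lambda t] over [1 <= t <= L (m + t0)] is at least
    [m + t0], and at most [m] of it is lost by starting at [m]; this also shows
    that [m <= L (m + t0)], each term being less than [1]. *)
Lemma lambda_sum_tail m i : (sigma_bar R D L k m <= i)%N ->
  (m <= i)%N /\
  expR (- (\sum_(m <= t < i) lambda t)) <= (12 * D%:R ^+ 2 * k.+1%:R)^-1.
Proof.
rewrite /sigma_bar; set t0 := `|Num.ceil _|%N; rewrite !addn1 => Li.
have l0 t : 0 <= lambda t by have /andP[/ltW] := hlambda t.
have l1 t : lambda t <= 1 by have /andP[_ /ltW] := hlambda t.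
have mi : (m <= i)%N.
  have := h3 (m + t0); rewrite big_add1 /= => hL.
  have : (m + t0)%:R <= (L (m + t0))%:R :> R.
    apply: (le_trans hL); rewrite -[in leRHS](subn0 (L _)) -sumr_const_nat.
    by apply: ler_sum => t _; apply: l1.
  by rewrite ler_nat => /(leq_trans (leq_addr _ _)) /leq_trans; apply; apply: ltnW.
split=> //.
have sum_ge : t0%:R <= \sum_(m <= t < i) lambda t.
  have hi : (m + t0)%:R <= \sum_(0 <= t < i) lambda t.
    apply: (le_trans (h3 _)).
    rewrite (big_cat_nat (n := (L (m + t0)).+1) (m := 0%N) (p := i))//=.
    by rewrite [X in _ <= X + _]big_ltn// -addrA addrCA lerDl addr_ge0// sumr_ge0.
  have hm : \sum_(0 <= t < m) lambda t <= m%:R.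
    rewrite -[in leRHS](subn0 m) -sumr_const_nat.
    by apply: ler_sum => t _; apply: l1.
  move: hi; rewrite (big_cat_nat (n := m) (m := 0%N) (p := i))//= natrD.
  move: hm; move: (\sum_(0 <= _ < _) _) (\sum_(m <= _ < _) _) => a b; lra.
have x0 : 0 < 12 * D%:R ^+ 2 * k.+1%:R :> R.
  by rewrite !mulr_gt0 ?ltr0n.
have -> : (12 * D%:R ^+ 2 * k.+1%:R)^-1 =
    expR (- ln (12 * D%:R ^+ 2 * k.+1%:R)) :> R by rewrite expRN lnK ?posrE.
rewrite ler_expR lerN2.
apply: (le_trans _ sum_ge).
have -> : 12 * D%:R ^+ 2 * k.+1%:R = (12 * D ^ 2 * k.+1)%:R :> R.
  by rewrite !(natrX, natrM).
rewrite /t0 addn1 (le_trans (Num.Theory.ceil_ge _))//.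
by rewrite [leRHS]pmulrn abszE ler_int ler_norm.
Qed.

(** Where [s] varies little the recurrence makes the residuals small, so that
    the inner products are at most [1/(32(k+1)^2)].  In the recurrence there
    remain three contributions, each at most a third of [1/(k+1)]: the initial
    value, damped by [lambda_sum_tail], the inner products, and the sum of the
    errors. *)
Lemma decrease_bound m (f : nat -> nat) (eps : R) i :
  (r3 c D ell k N <= m)%N ->
  (forall i, (m <= i <= (f_tilde R D L k f m).+1)%N ->
     sq q i - sq q i.+1 <= (r1 c N).+1%:R^-1 /\ `|J i q - q| <= eps) ->
  12 * D%:R * eps * (r1 c N)%:R <= 1 ->
  12 * D%:R * eps * (3 * k.+1%:R * (f_tilde R D L k f m).+1%:R) <= 1 ->
  (sigma_bar R D L k m <= i <= f_tilde R D L k f m)%N ->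
  sq q i <= k.+1%:R^-1.
Proof.
move=> rm hs er1 er4 /andP[si ift].
have c1 : 1 <= c%:R :> R by rewrite ler1n.
have D1 : 1 <= D%:R :> R by rewrite ler1n.
have K1 : 1 <= k.+1%:R :> R by rewrite ler1n.
set M := (f_tilde R D L k f m).+1 in hs er4 *.
pose V : R := (k.+1%:R ^+ 2)^-1.
have V0 : 0 < V by rewrite invr_gt0 exprn_gt0.
have Vk : V <= k.+1%:R^-1.
  by rewrite lef_pV2 ?posrE ?exprn_gt0//; rewrite expr2 ler_peMl//; lra.
have near t : (m <= t <= M)%N -> dot (u - q) (y t - q) <= V / 32.
  move=> tM; have [hdec qe] := hs _ tM.
  have /lambda_small[lN _ _] : (r3 c D ell k N <= t)%N.
    by rewrite (leq_trans rm)//; case/andP: tM.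
  rewrite [V / _]mulrC near_projection_iterate//.
  have key := key_recurrence qB qe.
  have dot3 := anchor_dot_le qB (iterates_in_ball t.+1).
  have /andP[l0 l1] := hlambda t.
  have hd : c%:R^-1 <= delta t ^+ 2 by have := h4 t; rewrite le_min => /andP[].
  have s0 : 0 <= sq q t by rewrite sqr_ge0.
  rewrite -[_ <= _](@ler_pXn2r _ 2%N) ?nnegrE ?invr_ge0// exprVn.
  set X := `|y t - J t (y t)| in key *.
  pose W : R := (N.+1%:R ^+ 2)^-1.
  have N0 : 0 < N.+1%:R ^+ 2 :> R by rewrite exprn_gt0.
  have N1 : 1 <= N.+1%:R ^+ 2 :> R by rewrite exprn_ege1// ler1n.
  have W0 : 0 < W by rewrite invr_gt0.
  have cN : 1 <= c%:R * N.+1%:R ^+ 2 :> R by rewrite mulr_ege1.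
  pose Z : R := (c%:R * N.+1%:R ^+ 2)^-1.
  have Z0 : 0 < Z by rewrite invr_gt0 (lt_le_trans ltr01).
  have cZ : c%:R^-1 * W = Z by rewrite /Z invfM.
  have cNZ : c%:R * N.+1%:R ^+ 2 * Z = 1.
    by rewrite mulfV// gt_eqF// (lt_le_trans ltr01).
  have r1E : (r1 c N).+1%:R = 12 * (c%:R * N.+1%:R ^+ 2) :> R.
    rewrite /r1 subn1 addn1 prednK ?muln_gt0 ?hc// !(natrX, natrM).
    by rewrite mulrA.
  have r1E' : (r1 c N)%:R = 12 * (c%:R * N.+1%:R ^+ 2) - 1 :> R.
    by rewrite -r1E -[in RHS]natr1 addrK.
  (* The three terms bounding the residual have coefficients of sum less
     than 1 in front of [Z = 1 / (c (N + 1)^2)]. *)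
  have d1 : sq q t - sq q t.+1 <= 12^-1 * Z.
    by move: hdec; rewrite r1E invfM.
  have d2 : 12 * D%:R * eps <= 11^-1 * Z.
    have e0 : 0 <= 12 * D%:R * eps by rewrite mulr_ge0// (le_trans _ qe).
    move: e0 er1; rewrite r1E'; move: (12 * D%:R * eps) => w w0 hw.
    have : w * (11 * (c%:R * N.+1%:R ^+ 2)) <= 1.
      by apply: le_trans hw; rewrite ler_wpM2l//; lra.
    move=> /(ler_wpM2l (ltW Z0)); rewrite mulr1.
    have -> : Z * (w * (11 * (c%:R * N.+1%:R ^+ 2))) =
      11 * w * (c%:R * N.+1%:R ^+ 2 * Z) by ring.
    by rewrite cNZ; lra.
  have d3 : 2 * lambda t * dot (u - q) (y t.+1 - q) <= 16^-1 * Z.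
    have /(ler_wpM2l (ltW Z0)) := lN; rewrite mulr1.
    have -> : Z * (lambda t * (96 * c%:R * D%:R ^+ 2 * N.+1%:R ^+ 2)) =
      96 * (lambda t * D%:R ^+ 2) * (c%:R * N.+1%:R ^+ 2 * Z) by ring.
    rewrite cNZ; have := ler_wpM2l (ltW l0) dot3.
    move: (dot _ _) (lambda t) (D%:R ^+ 2) => P l d; lra.
  have ls : 0 <= lambda t * sq q t by rewrite mulr_ge0// ltW.
  have dX : delta t ^+ 2 * X ^+ 2 <= Z.
    move: key d1 d2 d3 ls; move: (sq q t) (sq q t.+1) (delta t ^+ 2 * _) => s s' Y.
    move: (12 * _ * _) (lambda t) => w l; move: (2 * l * _) => P; lra.
  have ci0 : 0 < c%:R^-1 :> R by rewrite invr_gt0 (lt_le_trans ltr01).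
  rewrite -/W -(ler_pM2l ci0) cZ; apply: le_trans dX.
  by rewrite ler_wpM2r// sqr_ge0.
have [mi sumL] := lambda_sum_tail si.
have dV0 : 0 <= V / 16 by rewrite divr_ge0// ltW.
have [_ qe0] : sq q i - sq q i.+1 <= (r1 c N).+1%:R^-1 /\ `|J i q - q| <= eps.
  by apply: hs; rewrite mi ltnW.
have e0 : 0 <= 12 * D%:R * eps by rewrite mulr_ge0// (le_trans _ qe0).
have rec t : (m <= t < M)%N ->
    sq q t.+1 <= (1 - lambda t) * sq q t + lambda t * (V / 16) + 12 * D%:R * eps.
  move=> /andP[mt tM]; have [|_ qe] := hs t; first by rewrite mt ltnW.
  have key := key_recurrence qB qe.
  have := near t.+1; rewrite (leq_trans mt)//= tM => /(_ isT).
  have /andP[/ltW l0 _] := hlambda t.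
  move=> /(ler_wpM2l l0); move: key.
  have : 0 <= delta t ^+ 2 * `|y t - J t (y t)| ^+ 2 by rewrite mulr_ge0 ?sqr_ge0.
  move: (delta t ^+ 2 * _) (sq q t) (sq q t.+1) => Y s s'.
  by move: (dot _ _) (lambda t) (12 * _ * _) => P l w; lra.
have := halpern_recurrence_bound dV0 e0 (fun t => sqr_ge0 `|y t - q|) hlambda rec.
move=> /(_ i); rewrite mi (leqW ift) => /(_ isT) /le_trans; apply.
set S := \sum_(_ <= _ < _) _ in sumL *.
have K0 : 0 < k.+1%:R :> R by [].
have hexp : expR (- S) * sq q m <= 3^-1 * k.+1%:R^-1.
  have -> : 3^-1 * k.+1%:R^-1 = (12 * D%:R ^+ 2 * k.+1%:R)^-1 * (4 * D%:R ^+ 2) :> R.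
    by field; rewrite !gt_eqF// (lt_le_trans ltr01).
  by rewrite ler_pM ?expR_ge0 ?sqr_ge0 ?sq_le.
have herr : (i - m)%:R * (12 * D%:R * eps) <= 3^-1 * k.+1%:R^-1.
  have iM : (i - m)%:R <= M%:R :> R.
    by rewrite ler_nat (leq_trans (leq_subr _ _))// ltnW.
  rewrite (le_trans (ler_wpM2r e0 iM))// -invfM -[leRHS]div1r ler_pdivlMr ?mulr_gt0//.
  have -> : M%:R * (12 * D%:R * eps) * (3 * k.+1%:R) =
    12 * D%:R * eps * (3 * k.+1%:R * M%:R) by ring.
  exact: er4.
move: hexp herr Vk V0; move: (expR _ * _) (_%:R * (_ * eps)) (k.+1%:R^-1) => a b w.
by move: V {near rec dV0} => v; lra.
Qed.

End NearProjection.

(** * Metastability *)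

Hypothesis hh0 : forall n, (0 < h n)%N.
Hypothesis hh : {homo h : m n / (m <= n)%N}.
Hypothesis hL : {homo L : m n / (m <= n)%N}.
Context (k : nat) (f : nat -> nat).
Hypothesis hf : {homo f : m n / (m <= n)%N}.

Local Notation ft := (f_tilde R D L k f).
Local Notation g := (f_tilde2 R D L k f).
Local Notation Phi := (Phi R c D ell L k f).

Lemma sigma_bar_le m n : (m <= n)%N ->
  (sigma_bar R D L k m <= sigma_bar R D L k n)%N.
Proof. by move=> mn; rewrite /sigma_bar leq_add2r hL// leq_add2r. Qed.

Lemma f_tilde_le m n : (m <= n)%N -> (ft m <= ft n)%N.
Proof. by move=> mn; apply: hf; apply: sigma_bar_le. Qed.

Lemma f_tilde2_le : {homo g : m n / (m <= n)%N}.
Proof. by move=> m n mn; rewrite leq_add2r f_tilde_le. Qed.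

Lemma r1_le m n : (m <= n)%N -> (r1 c m <= r1 c n)%N.
Proof.
by move=> mn; rewrite leq_sub2r// leq_mul2l leq_exp2r// leq_add2r mn orbT.
Qed.

Lemma r2_le m n : (m <= n)%N -> (r2 D k m <= r2 D k n)%N.
Proof.
move=> mn; rewrite /r2 geq_max !leq_max leqnn orbT andbT.
by rewrite leq_mul2l leq_add2r mn.
Qed.

Lemma leq_maxn2 a b a' b' : (a <= a')%N -> (b <= b')%N ->
  (maxn a b <= maxn a' b')%N.
Proof. by move=> aa bb; rewrite geq_max !leq_max aa bb orbT. Qed.

Lemma r3_le m n : (m <= n)%N -> (r3 c D ell k m <= r3 c D ell k n)%N.
Proof.
move=> mn; apply: hell; apply: leq_maxn2; last apply: leq_maxn2 => //.
  by rewrite leq_sub2r// leq_mul2l leq_exp2r// leq_add2r mn orbT.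
by rewrite leq_mul2r leq_mul2l leq_exp2r// r2_le// !orbT.
Qed.

Lemma phi2_rates_le m n : (m <= n)%N ->
  (phi2 D (r1 c m) (r3 c D ell k m) g <= phi2 D (r1 c n) (r3 c D ell k n) g)%N.
Proof.
by move=> mn; apply: phi2_le; [exact: f_tilde2_le|exact: r1_le|exact: r3_le].
Qed.

Lemma Phi_le m n : (m <= n)%N -> (Phi m <= Phi n)%N.
Proof. by move=> mn; apply: f_tilde2_le; apply: phi2_rates_le. Qed.

Lemma r1_gt0 n : (0 < r1 c n)%N.
Proof.
rewrite /r1 subn_gt0 addn1; have : (0 < c * n.+1 ^ 2)%N by rewrite muln_gt0 hc expn_gt0.
by rewrite -mulnA; move: (c * _)%N => w; lia.
Qed.

Section FinalCases.
Context (N : nat) (q : H).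
Hypothesis qB : in_ball q.
Hypothesis qT : `|T q - q| <= (Xi R c D Cb h ell L k f N).+1%:R^-1.
Hypothesis qproj : forall q', in_ball q' -> `|T q' - q'| <= N.+1%:R^-1 ->
  dot (u - q) (q' - q) <= (32 * (k + 1) ^ 2 - 1).+1%:R^-1.

Lemma residual_le_of_Xi x i n j : (zeta c Cb j n <= x)%N -> (i <= n)%N ->
  (x <= Xi R c D Cb h ell L k f N)%N -> `|J i q - q| <= j.+1%:R^-1.
Proof.
move=> zx in_ xXi; apply: (@zeta_residual_le q j n) => //.
apply: (le_trans qT); rewrite lef_pV2 ?posrE// ler_nat ltnS.
exact: leq_trans xXi.
Qed.

(** The error allowed by [increase_bound] is proportional to [lambda tau],
    which is at least [1 / h (f (Phi N))] since [tau <= f (Phi N)] and [h] is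
    monotone. *)
Lemma increase_case t : (r3 c D ell k N <= t < Phi N)%N ->
  sq q t < sq q t.+1 ->
  forall i, (Phi N <= i <= f (Phi N))%N -> sq q i <= k.+1%:R^-1.
Proof.
move=> /andP[rt tP] st i /andP[Pi iF].
have [tau /andP[rtau ti] [stau sitau]] :=
  last_increase (s := fun i => sq q i) rt (leq_trans (ltnW tP) Pi) st.
apply: (le_trans sitau).
have tauF : (tau <= f (Phi N))%N by apply: leq_trans iF.
set a := (16 * h (f (Phi N)) * (k + 1) ^ 2 * (6 * D + 1))%N.
set b := (4 * c * r2 D k (Phi N) ^ 2 * (6 * D + 1))%N.
have qe : `|J tau q - q| <= (maxn a b).+1%:R^-1.
  apply: (residual_le_of_Xi _ tauF (leq_maxr _ _)).
  exact: leqnn.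
apply: (increase_bound qB qproj rtau stau qe).
have hF0 : 0 < (h (f (Phi N)))%:R :> R by rewrite ltr0n.
have htau : (h (f (Phi N)))%:R^-1 <= lambda tau.
  apply: le_trans (h1 tau); rewrite lef_pV2 ?posrE ?ltr0n// ler_nat.
  exact: hh.
apply: le_trans htau.
rewrite ler_pdivrMr ?ltr0n// -ler_pdivrMl ?invr_gt0// invrK mulrC.
have -> : 16 * k.+1%:R ^+ 2 * (6 * D%:R + 1) * (h (f (Phi N)))%:R = a%:R :> R.
  by rewrite /a addn1 !(natrX, natrM) natrD natrM; ring.
by rewrite ler_nat leqW// leq_maxl.
Qed.

(** The factor [2 (6 D + 1)] in the precision absorbs the [12 D] of the
    recurrence; [r1] serves to make the residuals small, and [r4] is large
    enough for the errors of all steps up to [f~ m] together. *)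
Lemma decrease_case m : (r3 c D ell k N <= m)%N ->
  (m <= phi2 D (r1 c N) (r3 c D ell k N) g)%N ->
  (forall t, (r3 c D ell k N <= t < Phi N)%N -> sq q t.+1 <= sq q t) ->
  sq q m - sq q (g m) <= (r1 c N).+1%:R^-1 ->
  forall i, (sigma_bar R D L k m <= i <= ft m)%N -> sq q i <= k.+1%:R^-1.
Proof.
move=> rm mphi dec drop i hi.
have gmP : (g m <= Phi N)%N by apply: f_tilde2_le.
have mono a b : (m <= a)%N -> (a <= b)%N -> (b <= g m)%N -> sq q b <= sq q a.
  move=> ma /subnK <-; elim: (b - a)%N => // d IH dg.
  apply: le_trans (IH (ltnW dg)); rewrite addSn dec//.
  rewrite (leq_trans rm) ?(leq_trans ma) ?leq_addl//=.
  exact: leq_trans gmP.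
set r := maxn (r1 c N) (r4 R c D ell L k f N).
have r0 : (0 < r)%N by rewrite /r leq_max r1_gt0.
set j := (2 * (6 * D + 1) * r - 1)%N.
have jE : j.+1%:R = 2 * (6 * D%:R + 1) * r%:R :> R.
  rewrite /j subn1 prednK ?muln_gt0 ?addn1 ?r0// !natrM.
  by rewrite -[(6 * D).+1%:R]natr1 natrM.
have r0' : 0 < r%:R :> R by rewrite ltr0n.
have D0' : 0 < D%:R :> R by rewrite ltr0n.
have small x : (x <= r)%N -> 12 * D%:R * j.+1%:R^-1 * x%:R <= 1 :> R.
  move=> xr; have xr' : x%:R <= r%:R :> R by rewrite ler_nat.
  rewrite mulrAC ler_pdivrMr ?ltr0n// mul1r jE.
  have := ler_wpM2l (ltW D0') xr'; lra.
apply: (decrease_bound qB qproj rm _ _ _ hi) => [t /andP[mt tf]||].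
- have tg : (t.+1 <= g m)%N by rewrite /f_tilde2 addn2 ltnS.
  split.
    apply: le_trans drop; apply: lerB; first by apply: mono => //; apply: ltnW.
    by apply: mono => //; rewrite leqW.
  apply: (@residual_le_of_Xi _ t (Phi N) j (leqnn _) _ (leq_maxl _ _)).
  exact: leq_trans (ltnW tg) gmP.
- by apply: small; rewrite leq_maxl.
- have := small (3 * k.+1 * (ft m).+1)%N; rewrite !natrM; apply.
  apply: leq_trans (leq_maxr _ _); rewrite /r4 !addn1 leq_mul2l ltnS.
  by rewrite f_tilde_le ?orbT.
Qed.

End FinalCases.

Lemma iterates_metastable : exists n : nat, (n <= mu R c D Cb h ell L k f)%N /\
  exists q : H, in_ball q /\
    forall i : nat, (n <= i <= f n)%N -> sq q i <= k.+1%:R^-1.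
Proof.
have ci0 : 0 < c%:R^-1 :> R by rewrite invr_gt0 ltr0n.
have [N Nb [q [qB qT qproj]]] := approx_projection hdot
  (fun a b => resolvent_nonexp hdot hA a b ci0)
  (resolvent_zero hdot hA ci0 hp) D0 uD
  (32 * (k + 1) ^ 2 - 1) (Xi R c D Cb h ell L k f).
set b := beta _ _ _ in Nb.
set rr := r3 c D ell k N.
have sig m : (m <= phi2 D (r1 c N) rr g)%N ->
    (sigma_bar R D L k m <= mu R c D Cb h ell L k f)%N.
  move=> mphi; rewrite /mu leq_max; apply/orP; left.
  by apply/sigma_bar_le/(leq_trans mphi)/phi2_rates_le.
(* Here [f (sigma_bar k r3) < r3 <= sigma_bar k r3], and the interval is
   empty. *)
have [gr|gr] := ltnP (g rr) rr.
  exists (sigma_bar R D L k rr); split; first by apply: sig; rewrite leq_maxl.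
  exists q; split=> // i /andP[si iF].
  have [rs _] := lambda_sum_tail (leqnn (sigma_bar R D L k rr)).
  have := leq_trans si iF; move: gr; rewrite /f_tilde2 /f_tilde; lia.
have [[t tP st]|noinc] := pselect (exists2 t, (rr <= t < Phi N)%N &
    sq q t < sq q t.+1).
  exists (Phi N); split.
    by rewrite /mu leq_max; apply/orP; right; apply: Phi_le.
  by exists q; split=> //; apply: (increase_case qB qT qproj tP st).
have [i|m [rm mphi mg drop]] := @phi2_metastable R D (r1 c N) rr g
  (fun i => sq q i) D0 f_tilde2_le gr.
  by rewrite sqr_ge0 natrM natrX sq_le.
exists (sigma_bar R D L k m); split; first exact: sig.
exists q; split=> //; apply: (decrease_case qB qT qproj rm mphi _ drop).
move=> t tP; rewrite leNgt; apply/negP => st; apply: noinc; by exists t.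
Qed.

End ProximalPoint.

Unset Implicit Arguments.

Theorem theorem3p5 (R : realType) (H : completeNormedModType R)
    (dot : {dot H for (idfun : R -> R)}) (hdot : inner_product dot)
    (A : H -> set H) (hA : maximal_monotone dot A) (hS : zeros A !=set0)
    (u z0 : H) (e : nat -> H) (cs lambda gamma delta : nat -> R)
    (hcs : forall n, 0 < cs n)
    (hlambda : forall n, 0 < lambda n < 1)
    (hdelta : forall n, 0 < delta n < 1)
    (hgamma : forall n, 0 <= gamma n < 1)
    (hsum : forall n, lambda n + gamma n + delta n = 1)
    (z y : nat -> H)
    (hz0 : z 0%N = z0)
    (hz : forall n, z n.+1 =
       lambda n *: u + gamma n *: z n + delta n *: resolvent A (cs n) (z n) + e n)
    (hy0 : y 0%N = z0)
    (hy : forall n, y n.+1 =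
       lambda n *: u + gamma n *: y n + delta n *: resolvent A (cs n) (y n))
    (c : nat) (h ell L E : nat -> nat)
    (hc : (0 < c)%N) (hh0 : forall n, (0 < h n)%N)
    (hh : monotone_fun h) (hell : monotone_fun ell)
    (hL : monotone_fun L) (hE : monotone_fun E)
    (h1 : forall n, (h n)%:R^-1 <= lambda n)
    (h2 : forall k n : nat, (ell k <= n)%N -> lambda n <= k.+1%:R^-1)
    (h3 : forall k : nat, k%:R <= \sum_(1 <= i < (L k).+1) lambda i)
    (h4 : forall n, c%:R^-1 <= Num.min (cs n) (delta n ^+ 2))
    (h5 : (forall k n : nat,
             \sum_((E k).+1 <= i < (E k + n).+1) `|e i| <= k.+1%:R^-1)
          \/ (forall k n : nat, (E k <= n)%N -> `|e n| / lambda n <= k.+1%:R^-1))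
    (D : nat) (hD0 : (0 < D)%N) (p : H) (hp : zeros A p)
    (hD : Num.max (2 * `|u - p|) `|z0 - p| <= D%:R)
    (Cb : nat -> nat) (hCb : monotone_fun Cb)
    (hcsCb : forall n, cs n <= (Cb n)%:R)
    (k : nat) (f : nat -> nat) (hf : monotone_fun f) :
  exists n : nat, (n <= mu R c D Cb h ell L k f)%N /\
    exists q : H, `|q - p| <= D%:R /\
      forall i : nat, (n <= i <= f n)%N -> `|y i - q| ^+ 2 <= k.+1%:R^-1.
Proof.
move: hD; rewrite ge_max => /andP[uD y0D].
apply: (iterates_metastable hdot hA hcs hlambda hdelta hgamma hsum hy hp hD0 uD).
all: rewrite ?hy0 //; exact: monotone_funP.
Qed.
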